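(* Let $\alpha$ be a composition of $n$ and let $\mathscr E:=D(X_\alpha,\mathrm w_{RB})$. (a) $C_{X_\alpha}=\{\Sigma_L(P_{T^x}):T\in\mathsf{ST}(\mathscr E^x)\}$. Furthermore, $$\min C_{X_\alpha}=[w_0(\mathrm{set}(\alpha)^c),\mathrm w_{RB}(\mathsf T'_\alpha)]_L\quad\text{and}\quad \max C_{X_\alpha}=[\mathrm w_{BR}(\mathsf T_\alpha),w_1(\mathrm{set}((\tilde\alpha')^{r}))]_L .$$ (b) $(C_{X_\alpha},\preceq)\cong(\mathsf{ST}(\mathscr E^x),\trianglelefteq)$ as posets.
   Context: Permutations. $n$ is a positive integer, $[n]=\{1,\dots,n\}$, $\mathfrak S_n$ the symmetric group (product = composition of maps; permutations written as words), $s_i=(i,i+1)$, $\ell(\sigma)$ Coxeter length, $w_0$ the longest element. $\mathrm{Des}_L(\sigma)=\{i:\ell(s_i\sigma)<\ell(\sigma)\}$, $\mathrm{Des}_R(\sigma)=\{i:\ell(\sigma s_i)<\ell(\sigma)\}$. $\preceq_L$ (resp. $\preceq_R$) has covers $\sigma\prec s_i\sigma$, $i\notin\mathrm{Des}_L(\sigma)$ (resp. $\sigma\prec\sigma s_i$, $i\notin\mathrm{Des}_R(\sigma)$); $[\sigma,\rho]_L$ is the interval for $\preceq_L$. For $S\subseteq[n-1]$, $S^{c}=[n-1]\setminus S$; $w_0(S)$ is the longest element of the subgroup generated by $\{s_i:i\in S\}$; $w_1(S)=w_0w_0(S^c)$ is the longest element of $\{z:\mathrm{Des}_R(z)\subseteq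 S\}$. For a composition $\alpha=(\alpha_1,\dots,\alpha_l)$ of $n$, $\ell(\alpha)=l$, $\mathrm{set}(\alpha)=\{\alpha_1,\dots,\alpha_1+\dots+\alpha_{l-1}\}$, $\alpha^r=(\alpha_l,\dots,\alpha_1)$, $\tilde\alpha$ is the partition obtained by sorting $\alpha$ weakly decreasingly, and $\tilde\alpha'$ is its conjugate partition. Classes. For nonempty left weak Bruhat intervals, $I_1\sim_D I_2$ iff there is a poset isomorphism $f:(I_1,\preceq_L)\to(I_2,\preceq_L)$ with $\mathrm{Des}_L(f(\gamma))=\mathrm{Des}_L(\gamma)$ for all $\gamma$. On a class $C$ put $[\sigma,\rho]_L\preceq[\sigma',\rho']_L$ iff $\sigma\preceq_R\sigma'$; it is known that $(C,\preceq)$ has a minimum and a maximum. Diagrams and fillings. Boxes are $(x,y)\in\mathbb Z_{>0}^2$ with $x$ = column from the left, $y$ = row from the bottom. For a diagram $D$ with $n$ boxes and no empty rows/columns, a standard filling is a bijection $F:D\to[n]$; $P_F$ is the poset on $[n]$ with $i\preceq j$ iff $x_i\le x_j$ and $y_i\le y_j$, where $(x_i,y_i)=F^{-1}(i)$; $\Sigma_L(P)=\{\sigma\in\mathfrak S_n:\sigma(i)\le\sigma(j)\text{ whenever }i\preceq_Pj\}$. $\mathsf{ST}(D)$: standard fillings $T$ with $T(i,j)\le T(k,l)$ whenever $i\le k$, $j\le l$, ordered by $T\trianglelefteq U$ iff $\mathrm w_{TL}(T)\preceq_L\mathrm w_{TL}(U)$, where $\mathrm w_{TL}$ reads each column top to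 bottom, leftmost column first. $D^x$, $T^x$: reflection across the $x$-axis (shifted upward to the first quadrant, touching the axes). Tableaux. $\mathrm{tcd}(\alpha)=\{(j,i):1\le i\le\ell(\alpha),1\le j\le\alpha_i\}$. A standard extended tableau (SET) of shape $\alpha$ is a bijective filling of $\mathrm{tcd}(\alpha)$ by $[n]$ with rows increasing left to right and every column increasing bottom to top. $\mathrm w_{RB}$ reads each row right to left, bottom row first; $\mathrm w_{BR}$ reads each column bottom to top, rightmost column first. $\mathsf T_\alpha$ is the SET filled with $1,\dots,n$ along rows left to right, bottom row first. $\mathsf T'_\alpha$ is the SET filled with $1,\dots,n$ up each column (bottom to top), leftmost column first. $C_{X_\alpha}$ is the $\sim_D$-class of $\{\mathrm w_{RB}(T):T\text{ an SET of shape }\alpha\}$, which is known to be the interval $[w_0(\mathrm{set}(\alpha)^c),\mathrm w_{RB}(\mathsf T'_\alpha)]_L$ ($X_\alpha$ is Searles's $H_n(0)$-module on SETs whose quasisymmetric characteristic is the extended Schur function). $D(X_\alpha,\mathrm w_{RB})=\{(j,i):(i,j)\in\mathrm{tcd}(\alpha)\}$, the transpose of $\mathrm{tcd}(\alpha)$. *)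

(* Defs.v *)
From HB Require Import structures.
From mathcomp Require Import all_boot all_fingroup zify.

Set Implicit Arguments.
Unset Strict Implicit.
Unset Printing Implicit Defensive.

(* Indices are 0-based throughout.  The set [n] = {1, ..., n} is 'I_n, with
   i : 'I_n standing for i + 1, and [n-1] = {1, ..., n-1} is 'I_n.-1, with
   i : 'I_n.-1 standing for i + 1. *)

(* MathComp's product s * t applies s first; left and right descents and weak
   orders refer here to composition of maps, which applies the right factor
   first. *)
Definition pcomp (n : nat) (s t : 'S_n) : 'S_n := (t * s)%g.

Lemma pcompE n (s t : 'S_n) i : pcomp s t i = s (t i).
Proof. by rewrite /pcomp permM. Qed.

Lemma lt_pred_widen n (i : 'I_n.-1) : i < n.
Proof. exact: leq_trans (ltn_ord i) (leq_pred n). Qed.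

Lemma lt_pred_succ n (i : 'I_n.-1) : i.+1 < n.
Proof. by case: n i => [|n] [i]. Qed.

Definition simple_refl (n : nat) (i : 'I_n.-1) : 'S_n :=
  tperm (Ordinal (lt_pred_widen i)) (Ordinal (lt_pred_succ i)).

Definition has_word (n : nat) (s : 'S_n) (k : nat) : bool :=
  [exists w : k.-tuple 'I_n.-1, s == \prod_(i <- w) simple_refl i]%g.

Lemma gen_simple_refl n :
  <<[set simple_refl i | i : 'I_n.-1]>>%g = [set: 'S_n].
Proof.
rewrite -[LHS]/(gval (generated_group _)); set G := generated_group _.
have inG (j i : 'I_n) d : j = i + d :> nat -> tperm i j \in G.
  elim: d j => [|d IHd] j Ej.
    have -> : j = i by apply: val_inj; rewrite /= Ej addn0.
    by rewrite tperm1 group1.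
  have lt_k : i + d < n by have := ltn_ord j; lia.
  have lt_k1 : i + d < n.-1 by have := ltn_ord j; lia.
  set k := Ordinal lt_k.
  have Gs : tperm k j \in G.
    rewrite (_ : tperm k j = simple_refl (Ordinal lt_k1)).
      by apply: mem_gen; apply: imset_f.
    by congr tperm; apply: val_inj => //=; rewrite Ej addnS.
  have [-> // | ne_ik] := eqVneq i k.
  have -> : tperm i j = (tperm i k ^ tperm k j)%g.
    rewrite tpermJ tpermL tpermD // 1?eq_sym //.
    by apply: contraTneq isT => /(congr1 val) /=; rewrite Ej; lia.
  by rewrite groupJ // IHd.
apply/eqP; rewrite eqEsubset subsetT; apply/subsetP => s _.
have [ts -> _] := prod_tpermP s; rewrite group_prod // => -[i j] /= _.
have [le_ij | /ltnW le_ji] := leqP i j.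
  by apply: (inG _ _ (j - i)); rewrite subnKC.
by rewrite tpermC; apply: (inG _ _ (i - j)); rewrite subnKC.
Qed.

Lemma has_word_ex n (s : 'S_n) : exists k, has_word s k.
Proof.
have : s \in <<[set simple_refl i | i : 'I_n.-1]>>%g.
  by rewrite gen_simple_refl inE.
case/gen_prodgP=> k [c cS ->]; exists k.
have [d dE] : exists d : {ffun 'I_k -> 'I_n.-1}, forall j, c j = simple_refl (d j).
  have cS' j : exists i, c j == simple_refl i.
    by have /imsetP[i _ ->] := cS j; exists i.
  by exists [ffun j => xchoose (cS' j)] => j; rewrite ffunE; apply/eqP; exact: (xchooseP (cS' j)).
apply/existsP; exists [tuple d j | j < k]; apply/eqP.
rewrite big_tuple; apply: eq_bigr => j _; by rewrite tnth_mktuple dE.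
Qed.

Definition coxlen (n : nat) (s : 'S_n) : nat := ex_minn (has_word_ex s).

Definition DesL (n : nat) (s : 'S_n) : {set 'I_n.-1} :=
  [set i | coxlen (pcomp (simple_refl i) s) < coxlen s].

Definition DesR (n : nat) (s : 'S_n) : {set 'I_n.-1} :=
  [set i | coxlen (pcomp s (simple_refl i)) < coxlen s].

Definition coverL (n : nat) : rel 'S_n := fun s t =>
  [exists i : 'I_n.-1, (i \notin DesL s) && (t == pcomp (simple_refl i) s)].

Definition coverR (n : nat) : rel 'S_n := fun s t =>
  [exists i : 'I_n.-1, (i \notin DesR s) && (t == pcomp s (simple_refl i))].

Definition leL (n : nat) : rel 'S_n := connect (@coverL n).
Definition leR (n : nat) : rel 'S_n := connect (@coverR n).

Definition intervalL (n : nat) (s t : 'S_n) : {set 'S_n} :=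
  [set g | leL s g && leL g t].

(* The element of maximal length in a parabolic subgroup is unique, so the
   choice made by arg max is immaterial. *)
Definition w0 (n : nat) (S : {set 'I_n.-1}) : 'S_n :=
  [arg max_(s > (1%g : 'S_n) in <<[set simple_refl i | i in S]>>%g) coxlen s].

Definition w1 (n : nat) (S : {set 'I_n.-1}) : 'S_n :=
  pcomp (w0 [set: 'I_n.-1]) (w0 (~: S)).

Definition is_comp (n : nat) (alpha : seq nat) : bool :=
  all (leq 1) alpha && (sumn alpha == n).

Definition comp_set (n : nat) (alpha : seq nat) : {set 'I_n.-1} :=
  [set i : 'I_n.-1 | i.+1 \in [seq sumn (take k alpha) | k <- iota 1 (size alpha).-1]].

Definition conj_part (la : seq nat) : seq nat :=
  [seq count (leq j) la | j <- iota 1 (head 0 la)].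

Definition is_poset_iso (X Y : finType) (A : {set X}) (B : {set Y})
    (leA : rel X) (leB : rel Y) (f : {ffun {x | x \in A} -> {y | y \in B}}) :=
  [&& injectiveb f, [forall y, y \in codom f] &
      [forall x, forall y, leB (val (f x)) (val (f y)) == leA (val x) (val y)]].

Definition is_intervalL (n : nat) (I : {set 'S_n}) : bool :=
  [exists s : 'S_n, exists t : 'S_n, leL s t && (I == intervalL s t)].

Definition equivD (n : nat) (I1 I2 : {set 'S_n}) : bool :=
  [&& is_intervalL I1, is_intervalL I2 &
      [exists f : {ffun {x | x \in I1} -> {y | y \in I2}},
         is_poset_iso (@leL n) (@leL n) f
         && [forall g, DesL (val (f g)) == DesL (val g)]]].

Definition classD (n : nat) (I : {set 'S_n}) : {set {set 'S_n}} :=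
  [set J | equivD I J].

(* Meaningful on nonempty intervals, whose two ends are determined by the set. *)
Definition leC (n : nat) : rel {set 'S_n} := fun I1 I2 =>
  [exists s1 : 'S_n, exists t1 : 'S_n, exists s2 : 'S_n, exists t2 : 'S_n,
     [&& leL s1 t1, I1 == intervalL s1 t1,
         leL s2 t2, I2 == intervalL s2 t2 & leR s1 s2]].

Definition is_minimum (X : finType) (C : {set X}) (le : rel X) (x : X) : Prop :=
  x \in C /\ (forall y, y \in C -> le x y).

Definition is_maximum (X : finType) (C : {set X}) (le : rel X) (x : X) : Prop :=
  x \in C /\ (forall y, y \in C -> le y x).

(* A diagram with n boxes and no empty row or column fits in an n x n grid.
   The pair (x, y) is the box in column x + 1 from the left and row y + 1 from
   the bottom. *)
Definition box (n : nat) : finType := ('I_n * 'I_n)%type.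

Definition filling (n : nat) (D : {set box n}) : finType :=
  {ffun {b | b \in D} -> 'I_n}.

Definition standard (n : nat) (D : {set box n}) (F : filling D) : bool :=
  injectiveb F && [forall k, k \in codom F].

Definition le_box (n : nat) : rel (box n) := fun b c =>
  (b.1 <= c.1) && (b.2 <= c.2).

Definition filling_rel (n : nat) (D : {set box n}) (F : filling D) : rel 'I_n :=
  fun i j => [exists b, exists c,
    [&& F b == i, F c == j & le_box (val b) (val c)]].

Definition SigmaL (n : nat) (P : rel 'I_n) : {set 'S_n} :=
  [set s : 'S_n | [forall i, forall j, P i j ==> (s i <= s j)]].

(* The two letters give the direction of reading: TL reads columns top to
   bottom, leftmost column first; RB reads rows right to left, bottom row first;
   BR reads columns bottom to top, rightmost column first; LB reads rows left to
   right, bottom row first; BL reads columns bottom to top, leftmost column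
   first. *)
Definition before_TL (n : nat) : rel (box n) := fun b c =>
  (b.1 < c.1) || (b.1 == c.1) && (c.2 <= b.2).
Definition before_RB (n : nat) : rel (box n) := fun b c =>
  (b.2 < c.2) || (b.2 == c.2) && (c.1 <= b.1).
Definition before_BR (n : nat) : rel (box n) := fun b c =>
  (c.1 < b.1) || (b.1 == c.1) && (b.2 <= c.2).
Definition before_LB (n : nat) : rel (box n) := fun b c =>
  (b.2 < c.2) || (b.2 == c.2) && (b.1 <= c.1).
Definition before_BL (n : nat) : rel (box n) := fun b c =>
  (b.1 < c.1) || (b.1 == c.1) && (b.2 <= c.2).

Definition boxes_by (n : nat) (before : rel (box n)) (D : {set box n}) :
    seq {b | b \in D} :=
  sort (fun b c => before (val b) (val c)) (enum {: {b | b \in D}}).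

(* The permutation with one-line notation w; the junk value 1 is returned when
   i |-> w_i is not a bijection of 'I_n. *)
Definition perm_of_word (n : nat) (w : seq 'I_n) : 'S_n :=
  insubd (1%g : 'S_n) [ffun i : 'I_n => nth i w i].

Definition read (n : nat) (before : rel (box n)) (D : {set box n})
    (F : filling D) : 'S_n :=
  perm_of_word [seq F b | b <- boxes_by before D].

Definition wTL n (D : {set box n}) (F : filling D) := read (@before_TL n) F.
Definition wRB n (D : {set box n}) (F : filling D) := read (@before_RB n) F.
Definition wBR n (D : {set box n}) (F : filling D) := read (@before_BR n) F.

Definition ST (n : nat) (D : {set box n}) : {set filling D} :=
  [set T : filling D | standard T &&
     [forall b, forall c, le_box (val b) (val c) ==> (T b <= T c)]].

Definition leST (n : nat) (D : {set box n}) : rel (filling D) := fun T U =>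
  leL (wTL T) (wTL U).

Definition top_row (n : nat) (D : {set box n}) : nat :=
  \max_(b in D) (b.2 : nat).

Lemma flip_row_subproof n (D : {set box n}) (b : box n) : b \in D ->
  top_row D - b.2 < n.
Proof.
move=> bD; apply: leq_ltn_trans (leq_subr _ _) _.
case: n D b bD => [|n] D b bD; first by case: (b.1).
by rewrite ltnS; apply/bigmax_leqP => c _; rewrite -ltnS.
Qed.

(* The default value of insubd is not used on the boxes of D.  The image touches
   the x-axis; it is D^x when D touches the y-axis. *)
Definition flip_box (n : nat) (D : {set box n}) (b : box n) : box n :=
  (b.1, insubd b.2 (top_row D - b.2)).

Definition flip (n : nat) (D : {set box n}) : {set box n} :=
  [set flip_box D b | b in D].

Lemma flip_box_in n (D : {set box n}) (b : box n) :
  b \in flip D -> flip_box D b \in D.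
Proof.
case/imsetP=> c cD ->.
suff -> : flip_box D (flip_box D c) = c by [].
have le_c : c.2 <= top_row D by by rewrite /top_row (bigD1 c) // leq_maxl.
case: c cD le_c => x y cD /= le_c; congr pair.
by apply: val_inj; rewrite !val_insubd /= (flip_row_subproof cD) /= subKn // ltn_ord.
Qed.

Definition flip_filling (n : nat) (D : {set box n}) (T : filling D) :
    filling (flip D) :=
  [ffun b => T (exist _ (flip_box D (val b)) (flip_box_in (valP b)))].

Definition tcd (n : nat) (alpha : seq nat) : {set box n} :=
  [set b : box n | b.1 < nth 0 alpha b.2].

Definition SET (n : nat) (alpha : seq nat) : {set filling (tcd n alpha)} :=
  [set T : filling (tcd n alpha) | [&& standard T,
     [forall b : {b | b \in tcd n alpha}, forall c : {b | b \in tcd n alpha},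
        ((val b).2 == (val c).2) && ((val b).1 < (val c).1) ==> (T b < T c)] &
     [forall b : {b | b \in tcd n alpha}, forall c : {b | b \in tcd n alpha},
        ((val b).1 == (val c).1) && ((val b).2 < (val c).2) ==> (T b < T c)]]].

(* The filling of D by 1, 2, ... along the order [before]; the default value
   of insubd is never used when D has at most n boxes. *)
Definition fill_along (n : nat) (before : rel (box n)) (D : {set box n}) :
    filling D :=
  [ffun b => insubd (val b).1 (index b (boxes_by before D))].

Definition T_rows (n : nat) (alpha : seq nat) : filling (tcd n alpha) :=
  fill_along (@before_LB n) (tcd n alpha).

Definition T_cols (n : nat) (alpha : seq nat) : filling (tcd n alpha) :=
  fill_along (@before_BL n) (tcd n alpha).

(* C_{X_alpha}, where X_alpha is Searles's 0-Hecke module on SETs; the set of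
   reading words is a left weak Bruhat interval. *)
Definition CX (n : nat) (alpha : seq nat) : {set {set 'S_n}} :=
  classD [set wRB T | T in SET n alpha].

(* D(X_alpha, w_RB) is the transpose of tcd(alpha). *)
Definition DX (n : nat) (alpha : seq nat) : {set box n} :=
  [set ((b.2, b.1) : box n) | b in tcd n alpha].

(* Main.v *)
(* The boxes of tcd(alpha) are identified with 'I_n by the reading order of
   T_alpha (rows left to right, bottom row first), so that T_alpha becomes the
   identity and a box has coordinates x, y.  SETs are then the permutations t
   monotone for the order NE (both coordinates weakly increase), and standard
   tableaux on E^x are the permutations f monotone for the order NW (x weakly
   decreases, y weakly increases).  Any two boxes are comparable for NE or for
   NW.  Write J(f) = {t o f^-1 : t a SET}, so that the reading words of the SETs
   form J(r), where r is the order read by w_RB.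

   Left weak order is containment of inversion sets, hence for f monotone for NW
   the set J(f) is the interval [f^-1, c o f^-1]_L, where c = T'_alpha, and both
   the order of J(f) and its left descents are independent of f.  Conversely an
   isomorphism out of J(r) that preserves left descents is a right translation,
   onto some J(f); comparing descents at T_alpha and at T'_alpha shows that f is
   monotone along the rows and the columns, hence for NW.  The order on the class
   becomes left weak order on the f's, whose extreme elements are r and the order
   m read by w_BR. *)

From mathcomp Require Import all_boot all_fingroup zify.
Require Import Defs.

Set Implicit Arguments.
Unset Strict Implicit.
Unset Printing Implicit Defensive.

(** * Inversion sets and weak orders *)

Definition Inv n (s : 'S_n) : {set 'I_n * 'I_n} :=
  [set p : 'I_n * 'I_n | (p.1 < p.2) && (s p.2 < s p.1)].

Lemma in_Inv n (s : 'S_n) a b : ((a, b) \in Inv s) = (a < b) && (s b < s a).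
Proof. by rewrite inE. Qed.

Lemma perm_ltn_neq n (s : 'S_n) a b : a != b -> (s a < s b) || (s b < s a).
Proof. by rewrite -neq_ltn -(inj_eq (@perm_inj _ s)). Qed.

(** The value [s a] is the number of points with a smaller value, so the comparisons determine
    [s]. *)
Lemma perm_lt_inj n (s t : 'S_n) :
  (forall a b, (s a < s b) = (t a < t b)) -> s = t.
Proof.
have rank (u : 'S_n) a : #|[set b | u b < u a]| = u a.
  have inj : injective (fun i : 'I_(u a) => u^-1%g (widen_ord (ltnW (ltn_ord (u a))) i)).
    by move=> i j /perm_inj/(congr1 val)/= /val_inj.
  rewrite -[RHS]card_ord -(card_imset _ inj).
  apply: eq_card => b; rewrite inE; apply/idP/imsetP => [lt_ba | [i _ ->]].
    exists (Ordinal lt_ba) => //; apply: (@perm_inj _ u); rewrite permKV.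
    exact: val_inj.
  by rewrite permKV /=.
move=> lt_st; apply/permP => a; apply: val_inj; rewrite /= -(rank s) -(rank t).
by apply: eq_card => b; rewrite !inE lt_st.
Qed.

Lemma Inv_inj n : injective (@Inv n).
Proof.
have lt_Inv (u : 'S_n) (a b : 'I_n) :
    (u a < u b) = if a < b then (a, b) \notin Inv u else (b, a) \in Inv u.
  rewrite !in_Inv; have [->|ne_ab] := eqVneq a b; first by rewrite !ltnn.
  have := perm_ltn_neq u ne_ab; move: ne_ab; rewrite -val_eqE /=.
  by case: (ltngtP a b) => // _ _; case: (ltngtP (u a) (u b)).
by move=> s t eqI; apply: perm_lt_inj => a b; rewrite !lt_Inv eqI.
Qed.

Definition lo n (i : 'I_n.-1) : 'I_n := Ordinal (lt_pred_widen i).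
Definition hi n (i : 'I_n.-1) : 'I_n := Ordinal (lt_pred_succ i).

Lemma simple_reflE n (i : 'I_n.-1) (a : 'I_n) :
  simple_refl i a =
    (if a == i :> nat then i.+1 else if a == i.+1 :> nat then i : nat else a) :> nat.
Proof.
rewrite /simple_refl; case: tpermP => [->|->|] /=.
- by rewrite eqxx.
- by rewrite eqxx; case: eqP => //; lia.
by move=> /eqP; rewrite -val_eqE => /negPf /= -> /eqP; rewrite -val_eqE => /negPf /= ->.
Qed.

Lemma simple_reflV n (i : 'I_n.-1) : ((simple_refl i)^-1 = simple_refl i)%g.
Proof. exact: tpermV. Qed.

Lemma pcomp_simpleK n (i : 'I_n.-1) (s : 'S_n) :
  pcomp (simple_refl i) (pcomp (simple_refl i) s) = s.
Proof. by apply/permP => a; rewrite !pcompE /simple_refl tpermK. Qed.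

(** The exchanged values are adjacent, so comparisons with any third value are unchanged and only
    the pair of their positions becomes a new inversion. *)
Lemma Inv_simple n (s : 'S_n) (i : 'I_n.-1) :
  (s^-1 (lo i) < s^-1 (hi i))%g ->
  Inv (pcomp (simple_refl i) s) = (s^-1 (lo i), s^-1 (hi i))%g |: Inv s.
Proof.
set p := (s^-1 (lo i))%g; set q := (s^-1 (hi i))%g => lt_pq.
have sp : s p = i :> nat by rewrite permKV.
have sq : s q = i.+1 :> nat by rewrite permKV.
apply/setP => -[a b]; rewrite in_setU1 !in_Inv !pcompE !simple_reflE xpair_eqE.
have eqp d : (d == p) = (s d == i :> nat).
  by rewrite -(inj_eq (@perm_inj _ s)) -val_eqE /= sp.
have eqq d : (d == q) = (s d == i.+1 :> nat).
  by rewrite -(inj_eq (@perm_inj _ s)) -val_eqE /= sq.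
rewrite eqp eqq.
have sab : (s a == s b :> nat) = (a == b :> nat) by rewrite !val_eqE (inj_eq (@perm_inj _ s)).
have := eqp a; have := eqp b; have := eqq a; have := eqq b.
rewrite -!val_eqE /=.
do ![case: (s _ =P _ :> nat)] => /=; lia.
Qed.

Lemma card_Inv_simple n (s : 'S_n) (i : 'I_n.-1) :
  (s^-1 (lo i) < s^-1 (hi i))%g ->
  #|Inv (pcomp (simple_refl i) s)| = #|Inv s|.+1.
Proof.
move=> lt_pq; rewrite Inv_simple // cardsU1 in_Inv lt_pq !permKV /=.
by rewrite -leqNgt leqnSn.
Qed.

Lemma simple_inv_swap n (s : 'S_n) (i : 'I_n.-1) :
  ((pcomp (simple_refl i) s)^-1 (lo i) = s^-1 (hi i))%g /\
  ((pcomp (simple_refl i) s)^-1 (hi i) = s^-1 (lo i))%g.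
Proof.
by rewrite /pcomp invMg !permM simple_reflV /simple_refl tpermL tpermR.
Qed.

Lemma lo_hi_cases n (s : 'S_n) (i : 'I_n.-1) :
  (s^-1 (lo i) < s^-1 (hi i))%g || (s^-1 (hi i) < s^-1 (lo i))%g.
Proof. by apply: perm_ltn_neq; rewrite -val_eqE /= neq_ltn leqnn. Qed.

Lemma card_Inv_simple_desc n (s : 'S_n) (i : 'I_n.-1) :
  (s^-1 (hi i) < s^-1 (lo i))%g ->
  #|Inv s| = #|Inv (pcomp (simple_refl i) s)|.+1.
Proof.
move=> gt_pq; rewrite -(@card_Inv_simple _ _ i) ?pcomp_simpleK //.
by have [-> ->] := simple_inv_swap s i.
Qed.

(** Without a descent [s] is increasing, by induction on the distance of two points, and only the
    identity is increasing. *)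
Lemma perm_descent n (s : 'S_n) : s != 1%g -> exists i : 'I_n.-1, s (hi i) < s (lo i).
Proof.
move=> s1; apply/existsP; apply: contra_neqT s1 => /existsPn asc.
have mono d (a b : 'I_n) : b = a + d :> nat -> s a <= s b.
  elim: d b => [|d IHd] b; first by rewrite addn0 => /val_inj ->.
  move=> Eb; have lt_ad : a + d < n.-1 by have := ltn_ord b; lia.
  apply: leq_trans (IHd (lo (Ordinal lt_ad)) erefl) _.
  have := asc (Ordinal lt_ad); rewrite -leqNgt.
  by rewrite (_ : hi _ = b) //; apply: val_inj; rewrite /= Eb addnS.
have monoW (a b : 'I_n) : a <= b -> s a <= s b.
  by move=> le_ab; apply: (mono (b - a)); lia.
apply: perm_lt_inj => a b; rewrite !perm1.
apply/idP/idP; first by rewrite !ltnNge; apply: contra; exact: monoW.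
move=> lt_ab; rewrite ltn_neqAle monoW ?(ltnW lt_ab) // andbT.
by rewrite val_eqE (inj_eq (@perm_inj _ s)) -val_eqE neq_ltn lt_ab.
Qed.

Lemma Inv1 n : Inv (1%g : 'S_n) = set0.
Proof. by apply/setP => -[a b]; rewrite in_Inv !perm1 inE; lia. Qed.

(** A descent of [t^-1] gives a reflection that removes one inversion of [t]; removing them all
    spells a word of that length. Conversely each letter of a word adds at most one inversion. *)
Lemma coxlenE n (s : 'S_n) : coxlen s = #|Inv s|.
Proof.
rewrite /coxlen; case: ex_minnP => k /existsP[w /eqP ->] min_k.
apply/eqP; rewrite eqn_leq; apply/andP; split.
  set g := (\prod_(i <- w) _)%g in min_k *; apply: min_k.
  move: {w}g => t; move Em: #|Inv t| => m.
  elim: m t Em => [|m IHm] t Em.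
    apply/existsP; exists [tuple]; rewrite big_nil.
    have [//|/perm_descent[i des]] := eqVneq t 1%g.
    by move/eqP: Em; rewrite cards_eq0 => /eqP/setP/(_ (lo i, hi i)); rewrite in_Inv des !inE leqnn.
  have t1 : (t^-1 != 1)%g.
    rewrite invg_eq1; apply: contra_eq_neq Em => ->.
    by rewrite Inv1 cards0.
  have [i des] := perm_descent t1; have := card_Inv_simple_desc des.
  rewrite Em => -[/esym/IHm/existsP[w /eqP Ew]].
  (* The last letter of a MathComp product is applied last, so in composition it is the leftmost
     factor. *)
  apply/existsP; exists [tuple of rcons w i]; rewrite big_rcons /=.
  by rewrite -{1}(pcomp_simpleK i t) Ew.
suff : forall l : seq 'I_n.-1, #|Inv (\prod_(i <- l) simple_refl i)%g| <= size l.
  by move=> /(_ w); rewrite size_tuple.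
elim/last_ind => [|l i IHl].
  by rewrite big_nil Inv1 cards0.
rewrite big_rcons size_rcons /=; set t := (\prod_(j <- l) _)%g in IHl *.
rewrite -[(t * _)%g]/(pcomp (simple_refl i) t).
case/orP: (lo_hi_cases t i) => [/card_Inv_simple -> // | /card_Inv_simple_desc E].
by apply: leq_trans (leqnSn _); apply: leq_trans IHl; rewrite E.
Qed.

Lemma in_DesL n (s : 'S_n) (i : 'I_n.-1) :
  (i \in DesL s) = (s^-1 (hi i) < s^-1 (lo i))%g.
Proof.
rewrite inE !coxlenE; case/orP: (lo_hi_cases s i) => lt_i.
  by rewrite card_Inv_simple // [RHS]ltnNge (ltnW lt_i); lia.
by rewrite lt_i [#|Inv s|](card_Inv_simple_desc lt_i) ltnSn.
Qed.

Lemma notin_DesL n (s : 'S_n) (i : 'I_n.-1) :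
  (i \notin DesL s) = (s^-1 (lo i) < s^-1 (hi i))%g.
Proof. by rewrite in_DesL; have := lo_hi_cases s i; lia. Qed.

Lemma coverL_Inv n (s t : 'S_n) : coverL s t -> Inv s \proper Inv t.
Proof.
case/existsP=> i /andP[]; rewrite notin_DesL => lt_i /eqP->.
rewrite Inv_simple // properUr // sub1set in_Inv !permKV lt_i /=; lia.
Qed.

(** Each cover enlarges the inversion set. Conversely, if [s] differs from [t], a descent of [t]
    composed with [s^-1] gives positions [p], [q] carrying adjacent values in [s] with [t q < t p].
    The inclusion forces [p < q], so exchanging these values is a cover whose new inversion belongs
    to [t]; the induction is on the number of missing inversions. *)
Lemma leLP n (s t : 'S_n) : leL s t = (Inv s \subset Inv t).
Proof.
apply/idP/idP => [/connectP[p]|].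
  elim: p s => [|u p IHp] s /= => [_ -> //|/andP[/coverL_Inv su pu] Et].
  exact: subset_trans (proper_sub su) (IHp _ pu Et).
have [m] := ubnP (#|Inv t| - #|Inv s|); elim: m s => // m IHm s le_m sub_st.
have [->|ne_st] := eqVneq s t; first exact: connect0.
have u1 : pcomp t s^-1 != 1%g.
  apply: contra ne_st => /eqP ust; apply/eqP.
  by apply/permP => a; rewrite -[in RHS](permK s a) -pcompE ust perm1.
have [i] := perm_descent u1; rewrite !pcompE.
set p := (s^-1 (lo i))%g; set q := (s^-1 (hi i))%g => lt_t.
have lt_pq : p < q.
  case/orP: (lo_hi_cases s i) => // lt_qp.
  have /(subsetP sub_st) : (q, p) \in Inv s by rewrite in_Inv lt_qp !permKV /=.
  by rewrite in_Inv; lia.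
have sub_ut : Inv (pcomp (simple_refl i) s) \subset Inv t.
  by rewrite Inv_simple // subUset sub1set in_Inv lt_pq lt_t.
have cov : coverL s (pcomp (simple_refl i) s).
  by apply/existsP; exists i; rewrite notin_DesL lt_pq /=.
apply: connect_trans (connect1 cov) (IHm _ _ sub_ut).
by have := subset_leq_card sub_ut; rewrite card_Inv_simple //; lia.
Qed.

Lemma leL_refl n (s : 'S_n) : leL s s.
Proof. exact: connect0. Qed.

Lemma leL_trans n (t s u : 'S_n) : leL s t -> leL t u -> leL s u.
Proof. exact: connect_trans. Qed.

Lemma leL_anti n (s t : 'S_n) : leL s t -> leL t s -> s = t.
Proof.
by rewrite !leLP => st ts; apply: Inv_inj; apply/eqP; rewrite eqEsubset st.
Qed.

Lemma leL_ltP n (s t : 'S_n) :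
  reflect (forall a b : 'I_n, a < b -> s b < s a -> t b < t a) (leL s t).
Proof.
rewrite leLP; apply: (iffP subsetP) => [sub a b lt_ab lt_s|sub [a b]].
  by have := sub (a, b); rewrite !in_Inv lt_ab lt_s => /(_ isT).
by rewrite !in_Inv => /andP[lt_ab /(sub _ _ lt_ab) ->]; rewrite lt_ab.
Qed.

Lemma card_InvV n (s : 'S_n) : #|Inv s^-1| = #|Inv s|.
Proof.
have inj : injective (fun p : 'I_n * 'I_n => (s p.2, s p.1)).
  by move=> [a b] [a' b'] /= [/perm_inj -> /perm_inj ->].
rewrite -[RHS](card_imset _ inj); apply: eq_card => -[a b]; apply/idP/imsetP.
  rewrite in_Inv => /andP[lt_ab lt_s].
  by exists (s^-1 b, s^-1 a)%g; rewrite ?in_Inv /= !permKV // lt_s.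
by case=> -[a' b']; rewrite in_Inv => /andP[lt_ab lt_s] [-> ->]; rewrite in_Inv !permK lt_s.
Qed.

(** Inverting preserves length and turns right multiplication into left multiplication, which
    reduces right weak order to inversion sets as well. *)
Lemma coverR_inv n (s t : 'S_n) : coverR s t = coverL s^-1%g t^-1%g.
Proof.
have inv_s i : (pcomp s (simple_refl i) = (pcomp (simple_refl i) s^-1)^-1)%g.
  by rewrite /pcomp invMg invgK simple_reflV.
apply: eq_existsb => i; rewrite !inE !coxlenE inv_s !card_InvV.
by rewrite -(inj_eq invg_inj) invgK.
Qed.

Lemma leR_inv n (s t : 'S_n) : leR s t = leL s^-1%g t^-1%g.
Proof.
apply/connectP/connectP => -[p].
  move=> st ->; exists ([seq u^-1%g | u <- p]); last by rewrite last_map.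
  by rewrite path_map; apply: sub_path st => u v; rewrite coverR_inv.
move=> st Et; exists ([seq u^-1%g | u <- p]); last by rewrite -[s]invgK last_map -Et invgK.
rewrite -[s]invgK path_map; apply: sub_path st => u v.
by rewrite /= coverR_inv !invgK.
Qed.

(** * Intervals and parabolic longest elements *)

(** Each end lies in both intervals, so antisymmetry identifies the ends; hence [leC] does not
    depend on a choice of ends. *)
Lemma intervalL_inj n (s t s' t' : 'S_n) : leL s t -> leL s' t' ->
  intervalL s t = intervalL s' t' -> s = s' /\ t = t'.
Proof.
move=> st st' /setP E.
have := E s; have := E t; have := E s'; have := E t'.
rewrite !inE !leL_refl st st' /= => /andP[s_t' t'_t] /andP[s_s' _].
move=> /esym/andP[_ t_t'] /esym/andP[s'_s _].
by split; apply: leL_anti.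
Qed.

Lemma leC_intervalL n (s t s' t' : 'S_n) : leL s t -> leL s' t' ->
  leC (intervalL s t) (intervalL s' t') = leR s s'.
Proof.
move=> st st'; apply/idP/idP.
  case/existsP=> s1 /existsP[t1 /existsP[s2 /existsP[t2]]].
  case/and5P=> st1 /eqP/(intervalL_inj st st1)[-> _] st2.
  by move=> /eqP/(intervalL_inj st' st2)[-> _].
move=> ss'; apply/existsP; exists s; apply/existsP; exists t.
by apply/existsP; exists s'; apply/existsP; exists t'; rewrite st st' !eqxx.
Qed.

(** * Parabolic subgroups as stabilizers of consecutive blocks *)

Section Parabolic.
Context (n : nat) (blk : 'I_n -> nat) (S : {set 'I_n.-1}).
Context (blk_mono : forall a b : 'I_n, a <= b -> blk a <= blk b).
Context (SE : forall i, (i \in S) = (blk (lo i) == blk (hi i))).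

Let W := <<[set simple_refl i | i in S]>>%g.

Lemma parabolic_blk (g : 'S_n) a : g \in W -> blk (g a) = blk a.
Proof.
case/gen_prodgP=> k [c cS ->].
elim: k c cS a => [|k IHk] c cS a; first by rewrite big_ord0 perm1.
rewrite big_ord_recr permM /=; have /imsetP[i Si ->] := cS ord_max.
rewrite -(IHk (fun j => c (widen_ord (leqnSn k) j)) _ a) //.
rewrite /simple_refl.
by case: tpermP => // ->; move: Si; rewrite SE => /eqP.
Qed.

Lemma parabolic_Inv (g : 'S_n) : g \in W ->
  forall a b : 'I_n, a < b -> g b < g a -> blk a = blk b.
Proof.
move=> Wg a b lt_ab lt_g; apply/eqP; rewrite eqn_leq blk_mono ?(ltnW lt_ab) //=.
by rewrite -(parabolic_blk a Wg) -(parabolic_blk b Wg) blk_mono // ltnW.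
Qed.

(** Induction on the number of inversions: a descent of [g] is an inversion, so its reflection stays
    within a block and lies in [W], and composing with it removes one inversion. *)
Lemma mem_parabolic (g : 'S_n) :
  (forall a b : 'I_n, a < b -> g b < g a -> blk a = blk b) -> g \in W.
Proof.
have [m] := ubnP #|Inv g|; elim: m g => // m IHm g le_m gI.
have [->|/perm_descent[i des]] := eqVneq g 1%g; first exact: group1.
have blk_i : blk (lo i) = blk (hi i) by apply: gI => //=.
have Wi : simple_refl i \in W by apply/mem_gen/imset_f; rewrite SE blk_i.
rewrite -(groupMl g Wi); apply: IHm.
  rewrite -card_InvV invMg simple_reflV -[(_ * simple_refl i)%g]/(pcomp (simple_refl i) g^-1).
  by move: le_m; rewrite -card_InvV (@card_Inv_simple_desc _ _ i) // invgK.
move=> a b lt_ab; rewrite !permM => lt_g.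
have blk_s d : blk (simple_refl i d) = blk d.
  by rewrite /simple_refl; case: tpermP => // ->; rewrite -/(lo i) -/(hi i) blk_i.
(* The reflection reverses only the pair [lo i], [hi i], and for that pair [lt_g] contradicts the
   descent [des]. *)
have lt_s : simple_refl i a < simple_refl i b.
  have := lt_g; have : simple_refl i a != simple_refl i b.
    by rewrite (inj_eq perm_inj) -val_eqE /= neq_ltn lt_ab.
  rewrite -val_eqE /= !simple_reflE => ne_ab.
  case: (a =P i :> nat) ne_ab => [Ea|_]; last by do !case: eqP; lia.
  case: (b =P i.+1 :> nat) => [Eb|_]; last by do !case: eqP; lia.
  have -> : a = lo i by apply: val_inj.
  have -> : b = hi i by apply: val_inj.
  by rewrite /simple_refl tpermL tpermR; move: des; rewrite /lo /hi; lia.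
by rewrite -blk_s -[blk b]blk_s; apply: gI.
Qed.

(** Elements of [W] invert only pairs within a block, and [s] inverts all of these. So [s] is the
    only element of [W] with that many inversions, and its inverse, of the same length, equals
    it. *)
Lemma w0_blockwise (s : 'S_n) :
  (forall a b : 'I_n, a < b -> (s b < s a) = (blk a == blk b)) ->
  w0 S = s /\ (s^-1 = s)%g.
Proof.
move=> sE.
have Ws : s \in W by apply: mem_parabolic => a b lt_ab; rewrite sE // => /eqP.
have max_s g : g \in W -> #|Inv s| <= #|Inv g| -> g = s.
  move=> Wg le_sg; apply: Inv_inj; apply/eqP; rewrite eqEcard le_sg andbT.
  apply/subsetP => -[a b]; rewrite !in_Inv => /andP[lt_ab lt_g].
  by rewrite lt_ab sE // (parabolic_Inv Wg lt_ab lt_g) /=.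
split; last by apply: max_s; rewrite ?groupV ?card_InvV.
rewrite /w0; case: arg_maxnP => [|g Wg max_g]; first exact: group1.
by apply: max_s => //; rewrite -!coxlenE; apply: max_g.
Qed.

End Parabolic.

Lemma w0_setT n : w0 [set: 'I_n.-1] = perm (@rev_ord_inj n).
Proof.
have [] // := @w0_blockwise n (fun=> 0) [set: 'I_n.-1] _ _ (perm (@rev_ord_inj n)).
  by move=> i; rewrite inE.
by move=> a b lt_ab; rewrite !permE /=; have := ltn_ord b; lia.
Qed.

(** * Compositions as block sizes *)

Section CompSet.
Context (n : nat) (blk : 'I_n -> nat) (beta : seq nat).
Context (blk_mono : forall a b : 'I_n, a <= b -> blk a <= blk b).
Context (blk_lt : forall a, blk a < size beta).
Context (blk_fib : forall k, k < size beta -> #|[set a | blk a == k]| = nth 0 beta k).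

Lemma card_blk_lt k : k <= size beta -> #|[set a | blk a < k]| = sumn (take k beta).
Proof.
elim: k => [|k IHk] le_k.
  by rewrite take0 (_ : [set a | _] = set0) ?cards0 //; apply/setP => a; rewrite !inE.
rewrite (take_nth 0) // sumn_rcons -(IHk (ltnW le_k)) -blk_fib // -cardsUI.
have -> : [set a | blk a < k] :&: [set a | blk a == k] = set0.
  by apply/setP => a; rewrite !inE; case: ltngtP.
rewrite cards0 addn0; apply: eq_card => a.
by rewrite !inE ltnS leq_eqVlt orbC.
Qed.

(** A partial sum of [beta] counts the points of the first blocks, and [i.+1] counts the points up
    to [lo i]. Both sets are initial segments, so the numbers agree exactly when a cut between
    blocks falls after [lo i]. *)
Lemma comp_setC_blk i : (i \in ~: comp_set n beta) = (blk (lo i) == blk (hi i)).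
Proof.
have card_le (j : 'I_n) : #|[set a : 'I_n | a <= j]| = j.+1.
  rewrite -[RHS]card_ord.
  have inj : injective (widen_ord (ltn_ord j)) by move=> a b /(congr1 val)/= /val_inj.
  rewrite -(card_imset _ inj); apply: eq_card => a; rewrite inE.
  apply/idP/imsetP => [le_aj | [b _ ->]]; last by rewrite /= -ltnS.
  by exists (Ordinal (le_aj : a < j.+1)) => //; apply: val_inj.
rewrite !inE -[RHS]negbK; congr (~~ _).
apply/mapP/idP => [[k] | ne_i].
  rewrite mem_iota => /andP[k_gt0 lt_k] E.
  rewrite neq_ltn; apply/orP; left.
  have le_k : k <= size beta by lia.
  have := card_blk_lt le_k; rewrite -E -(card_le (lo i)) => eq_card.
  have [lt_hi|le_hi] := ltnP (blk (hi i)) k.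
    have : #|[set a : 'I_n | a <= hi i]| <= #|[set a | blk a < k]|.
      apply: subset_leq_card; apply/subsetP => a; rewrite !inE => /blk_mono.
      by move/leq_ltn_trans; apply.
    by rewrite eq_card !card_le /= ltnn.
  apply: leq_trans le_hi; rewrite ltnNge; apply/negP => le_lo.
  have : #|[set a | blk a < k]| <= #|[set a : 'I_n | a < lo i]|.
    apply: subset_leq_card; apply/subsetP => a; rewrite !inE ltnNge => lt_a.
    by rewrite ltnNge; apply: contra lt_a => /blk_mono; apply: leq_trans.
  have : #|[set a : 'I_n | a < lo i]| < #|[set a : 'I_n | a <= lo i]|.
    apply: proper_card; apply/properP; split.
      by apply/subsetP => a; rewrite !inE => /ltnW.
    by exists (lo i); rewrite !inE ?ltnn.
  by rewrite eq_card; lia.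
have lt_i : blk (lo i) < blk (hi i).
  by rewrite ltn_neqAle ne_i blk_mono //=.
(* The partial sum sought is over the blocks preceding that of [hi i]; since [lo i] is in one of
   them, the index is at least 1. *)
exists (blk (hi i)); first by rewrite mem_iota; have := blk_lt (hi i); lia.
rewrite -card_blk_lt ?(ltnW (blk_lt _)) // -(card_le (lo i)).
apply: eq_card => a; rewrite !inE; apply/idP/idP => [/blk_mono le_a|].
  exact: leq_ltn_trans lt_i.
move=> lt_blk; rewrite leqNgt; apply: contraL lt_blk => lt_a; rewrite -leqNgt.
exact: blk_mono.
Qed.

End CompSet.

(** * Intervals attached to a planar poset *)

Lemma SigmaLP n (P : rel 'I_n) (s : 'S_n) :
  reflect (forall a b, P a b -> s a <= s b) (s \in SigmaL P).
Proof.
rewrite inE; apply: (iffP forallP) => [sP a b|sP a].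
  by move/forallP/(_ b)/implyP: (sP a).
by apply/forallP => b; apply/implyP; exact: sP.
Qed.

Lemma SigmaL_lt n (P : rel 'I_n) (s : 'S_n) a b :
  s \in SigmaL P -> P a b -> a != b -> s a < s b.
Proof.
move=> /SigmaLP sP /sP le_s; apply: contraNltn => le_ba.
by rewrite -(inj_eq (@perm_inj _ s)) -val_eqE eqn_leq le_s.
Qed.

(** The maps at hand run from [B] to [A], whereas the isomorphism is wanted from [A] to [B] as a
    finite function; choice inverts them. *)
Lemma poset_iso_of_inverse (X Y : finType) (A : {set X}) (B : {set Y})
    (leA : rel X) (leB : rel Y) (psi : Y -> X) :
  {in B, forall b, psi b \in A} -> {in B &, injective psi} ->
  {in A, forall a, exists2 b, b \in B & psi b = a} ->
  {in B &, forall b b', leA (psi b) (psi b') = leB b b'} ->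
  exists2 f : {ffun {x | x \in A} -> {y | y \in B}},
    is_poset_iso leA leB f & forall a, psi (val (f a)) = val a.
Proof.
move=> psiA psi_inj psi_onto psi_mono.
have ex_b (a : {x | x \in A}) : exists b : {y | y \in B}, psi (val b) == val a.
  by have [b bB Eb] := psi_onto _ (valP a); exists (exist _ b bB); rewrite /= Eb.
pose f := [ffun a => xchoose (ex_b a)].
have psif a : psi (val (f a)) = val a.
  by rewrite ffunE; apply/eqP; exact: (xchooseP (ex_b a)).
exists f => //; apply/and3P; split.
- by apply/injectiveP => a a' Ef; apply: val_inj; rewrite /= -!psif Ef.
- apply/forallP => b; apply/codomP; exists (exist _ (psi (val b)) (psiA _ (valP b))).
  by apply: val_inj; apply: psi_inj; rewrite ?psif //; apply: valP.
by apply/forallP => a; apply/forallP => a'; rewrite -psi_mono ?psif //; apply: valP.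
Qed.

Lemma pcompA n (s t u : 'S_n) : pcomp s (pcomp t u) = pcomp (pcomp s t) u.
Proof. by apply/permP => a; rewrite !pcompE. Qed.

(** Exchanging values [i] and [i+1] that stand in order moves the smaller one right and the larger
    one left when each is compared with its other neighbour in value, so no descent other than [i]
    is created. *)
Lemma DesL_cover n (s : 'S_n) (i j : 'I_n.-1) :
  i \notin DesL s -> j \notin DesL s -> j \in DesL (pcomp (simple_refl i) s) -> j = i.
Proof.
rewrite !notin_DesL in_DesL /pcomp invMg !permM simple_reflV => lt_i lt_j.
have E v : simple_refl i v = if v == lo i then hi i else if v == hi i then lo i else v.
  rewrite /simple_refl; case: tpermP => [->|->|/eqP/negPf-> /eqP/negPf->].
  - by rewrite eqxx.
  - by rewrite eqxx; case: eqP.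
  - by [].
have [-> //|ne_ij] := eqVneq j i.
have ne_ll : (lo j == lo i) = false by apply: negbTE; rewrite -val_eqE.
have ne_hh : (hi j == hi i) = false by apply: negbTE; rewrite -val_eqE /= eqSS.
rewrite !E ne_ll ne_hh.
case: eqP => [Eh|_]; case: eqP => [El|_]; rewrite ltnNge.
- by move/(congr1 val): Eh; move/(congr1 val): El => /=; lia.
- by rewrite ltnW // (ltn_trans _ lt_i) // -Eh.
- by rewrite ltnW // (ltn_trans lt_i) // -El.
- by rewrite ltnW.
Qed.

(** A cover adds a single inversion, which leaves no room for an inversion set strictly between. *)
Lemma coverL_between n (s t u : 'S_n) : coverL s t -> leL s u -> leL u t ->
  u != s -> u = t.
Proof.
case/existsP=> i /andP[]; rewrite notin_DesL => lt_i /eqP-> /[!leLP] su ut ne_us.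
apply: Inv_inj; apply/eqP; rewrite eqEcard ut card_Inv_simple //.
apply: proper_card; rewrite properE su; apply: contra ne_us => us.
by apply/eqP/Inv_inj/eqP; rewrite eqEsubset us.
Qed.

Definition weakly_NE n (x y : 'I_n -> nat) : rel 'I_n :=
  fun a b => (x a <= x b) && (y a <= y b).
Definition weakly_NW n (x y : 'I_n -> nat) : rel 'I_n :=
  fun a b => (x b <= x a) && (y a <= y b).

(** This is J(f): [pcomp t f^-1] lists the entries of [t] in the order in which [f] visits the
    boxes. *)
Definition translateSigma n (x y : 'I_n -> nat) (f : 'S_n) : {set 'S_n} :=
  [set pcomp t f^-1 | t in SigmaL (weakly_NE x y)].

Section Core.
Context (n : nat) (x y : 'I_n -> nat) (c r m : 'S_n).
Context (idE : forall a b : 'I_n, (a <= b) = (y a < y b) || (y a == y b) && (x a <= x b)).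
Context (cE : forall a b, (c a <= c b) = (x a < x b) || (x a == x b) && (y a <= y b)).
Context (rE : forall a b, (r a <= r b) = (y a < y b) || (y a == y b) && (x b <= x a)).
Context (mE : forall a b, (m a <= m b) = (x b < x a) || (x a == x b) && (y a <= y b)).
(** Rows have no gap on the left. This supplies the corner boxes in the arguments about descents. *)
Context (left_justified : forall b k, k <= x b -> exists2 d, x d = k & y d = y b).

Local Notation P := (weakly_NE x y).
Local Notation Q := (weakly_NW x y).
Local Notation J := (translateSigma x y).

Lemma id_SigmaL : 1%g \in SigmaL P.
Proof. by apply/SigmaLP => a b /andP[le_x le_y]; rewrite !perm1 idE; lia. Qed.

Lemma c_SigmaL : c \in SigmaL P.
Proof. by apply/SigmaLP => a b /andP[le_x le_y]; rewrite cE; lia. Qed.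

Lemma r_SigmaL : r \in SigmaL Q.
Proof. by apply/SigmaLP => a b /andP[le_x le_y]; rewrite rE; lia. Qed.

Lemma m_SigmaL : m \in SigmaL Q.
Proof. by apply/SigmaLP => a b /andP[le_x le_y]; rewrite mE; lia. Qed.

Lemma PQ_cases a b : [|| P a b, P b a, Q a b | Q b a].
Proof. by rewrite /weakly_NE /weakly_NW; lia. Qed.

Lemma pcomp1l (f : 'S_n) : pcomp 1 f = f.
Proof. by apply/permP => a; rewrite pcompE perm1. Qed.

Lemma leL_conj (f t u : 'S_n) :
  leL (pcomp t f^-1) (pcomp u f^-1) <->
  (forall a b, f a < f b -> t b < t a -> u b < u a).
Proof.
split=> [/leL_ltP le_tu a b lt_f lt_t|tu].
  by have := le_tu _ _ lt_f; rewrite !pcompE !permK => /(_ lt_t).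
by apply/leL_ltP => a b lt_ab; rewrite !pcompE; apply: tu; rewrite !permKV.
Qed.

(** On a pair comparable for NE, [t] and [u] agree; on a pair comparable for NW, [f] and [g] agree.
    Every pair is of one of these kinds. *)
Lemma leL_conj_eq (f g t u : 'S_n) :
  f \in SigmaL Q -> g \in SigmaL Q -> t \in SigmaL P -> u \in SigmaL P ->
  leL (pcomp t f^-1) (pcomp u f^-1) = leL (pcomp t g^-1) (pcomp u g^-1).
Proof.
move=> fQ gQ tP uP.
wlog suff: f g fQ gQ / leL (pcomp t f^-1) (pcomp u f^-1) -> leL (pcomp t g^-1) (pcomp u g^-1).
  by move=> H; apply/idP/idP; apply: H.
move=> /leL_conj tu; apply/leL_conj => a b lt_g lt_t.
have ne_ab : b != a by apply: contraTneq lt_t => ->; rewrite ltnn.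
case/or4P: (PQ_cases a b) => [|ba|ab|].
- by move/SigmaLP: tP => tP /tP; rewrite leqNgt lt_t.
- exact: SigmaL_lt uP ba ne_ab.
- by apply: tu lt_t; apply: SigmaL_lt fQ ab _; rewrite eq_sym.
- by move/SigmaLP: gQ => gQ /gQ; rewrite leqNgt lt_g.
Qed.

Lemma leL_ends f : f \in SigmaL Q -> leL f^-1%g (pcomp c f^-1).
Proof.
move=> /SigmaLP fQ; rewrite -{1}[f^-1%g]pcomp1l; apply/leL_conj => a b lt_f.
rewrite !perm1 => lt_ba; rewrite ltnNge; apply/negP.
have : ~~ Q b a by apply: contraL lt_f => /fQ; rewrite -leqNgt.
by move: lt_ba; rewrite ltnNge idE cE /weakly_NW; lia.
Qed.

(** The ends come from the row filling 1 and the column filling [c]. Among pairs whose order is not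
    dictated by NW, a monotone [t] lies between the two. Conversely 1 and [c] agree on NE pairs, so
    the bounds force [t] to be monotone there. *)
Lemma J_interval f : f \in SigmaL Q -> J f = intervalL f^-1%g (pcomp c f^-1).
Proof.
move=> /SigmaLP fQ; apply/setP => s; rewrite [RHS]inE; apply/imsetP/andP.
  case=> t /SigmaLP tP ->; split.
    rewrite -{1}[f^-1%g]pcomp1l; apply/leL_conj => a b lt_f; rewrite !perm1 => lt_ba.
    have nQ : ~~ Q b a by apply: contraL lt_f => /fQ; rewrite -leqNgt.
    have ba : P b a by move: lt_ba nQ; rewrite ltnNge idE /weakly_NE /weakly_NW; lia.
    apply: SigmaL_lt ba _; first exact/SigmaLP.
    by rewrite -val_eqE neq_ltn lt_ba.
  apply/leL_conj => a b lt_f lt_t.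
  have nQ : ~~ Q b a by apply: contraL lt_f => /fQ; rewrite -leqNgt.
  have nP : ~~ P a b by apply: contraL lt_t => /tP; rewrite -leqNgt.
  by rewrite ltnNge cE; move: nP nQ; rewrite /weakly_NE /weakly_NW; lia.
have -> : s = pcomp (pcomp s f) f^-1.
  by apply/permP => a; rewrite !pcompE permKV.
set t := pcomp s f; rewrite -{1}[f^-1%g]pcomp1l => -[/leL_conj lo_t /leL_conj t_hi].
exists t => //; apply/SigmaLP => a b ab; rewrite leqNgt; apply/negP => lt_t.
have ne_ab : a != b by apply: contraTneq lt_t => ->; rewrite ltnn.
have lt_ab := SigmaL_lt id_SigmaL ab ne_ab.
have lt_c := SigmaL_lt c_SigmaL ab ne_ab.
(* If [f] visits [a] first, the upper bound forbids the inversion; otherwise the lower bound imposes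
   the order of 1. *)
case/orP: (perm_ltn_neq f ne_ab) => lt_f.
  by have := t_hi _ _ lt_f lt_t; rewrite ltnNge (ltnW lt_c).
by have := lo_t _ _ lt_f lt_ab; rewrite ltnNge (ltnW lt_t).
Qed.

Lemma in_J f s : f \in SigmaL Q ->
  (s \in J f) = leL f^-1%g s && leL s (pcomp c f^-1).
Proof. by move=> /J_interval ->; rewrite inE. Qed.

(** The lower ends are [f^-1] and [g^-1], and inversion exchanges the two weak orders. *)
Lemma leC_J f g : f \in SigmaL Q -> g \in SigmaL Q -> leC (J f) (J g) = leL f g.
Proof.
by move=> fQ gQ; rewrite !J_interval // leC_intervalL ?leL_ends // leR_inv !invgK.
Qed.

Lemma DesL_conj (t f : 'S_n) i :
  (i \in DesL (pcomp t f^-1)) = (f (t^-1 (hi i)) < f (t^-1 (lo i)))%g.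
Proof. by rewrite in_DesL /pcomp invMg invgK !permM. Qed.

(** A descent at [i] compares [f] at the boxes [a], [b] where [t] takes consecutive values. On
    NW-comparable boxes [f] and [g] agree. Otherwise [b] is strictly above and to the right of [a],
    and the corner [d] would need a value strictly between two consecutive ones. *)
Lemma DesL_conj_eq (f g t : 'S_n) :
  f \in SigmaL Q -> g \in SigmaL Q -> t \in SigmaL P ->
  DesL (pcomp t f^-1) = DesL (pcomp t g^-1).
Proof.
move=> fQ gQ tP; apply/setP => i; rewrite !DesL_conj.
set b := (t^-1 (hi i))%g; set a := (t^-1 (lo i))%g.
have ta : t a = i :> nat by rewrite permKV.
have tb : t b = i.+1 :> nat by rewrite permKV.
have ne_ab : a != b by apply: contra_eq_neq ta => ->; rewrite tb neq_ltn leqnn orbT.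
have [ab|nab] := boolP (Q a b).
  by rewrite !ltnNge !(ltnW (SigmaL_lt _ ab ne_ab)).
have [ba|nba] := boolP (Q b a).
  by rewrite !(SigmaL_lt _ ba) // eq_sym.
have nPba : ~~ P b a.
  by apply/negP => /(elimT (SigmaLP _ _) tP); rewrite ta tb ltnn.
have [d xd yd] : exists2 d, x d = x a & y d = y b.
  by apply: left_justified; move: nab nba nPba; rewrite /weakly_NE /weakly_NW; lia.
have ad : P a d by move: nab nba nPba; rewrite /weakly_NE /weakly_NW; lia.
have db : P d b by move: nab nba nPba; rewrite /weakly_NE /weakly_NW; lia.
have ne_ad : a != d by apply/eqP => Ea; move: yd nab nba; rewrite -Ea /weakly_NW; lia.
have ne_db : d != b by apply/eqP => Ed; move: xd nab nba; rewrite Ed /weakly_NW; lia.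
have := SigmaL_lt tP db ne_db.
by rewrite tb ltnS leqNgt -ta (SigmaL_lt tP ad ne_ad).
Qed.

(* [T_rows] and [T_cols], i.e. [1] and [c], put any two horizontally, resp.
   vertically, adjacent boxes next to each other in value, so their descents
   already force [f] to be monotone. *)
Lemma SigmaL_of_DesL (f : 'S_n) :
  DesL f^-1%g = DesL r^-1%g -> DesL (pcomp c f^-1) = DesL (pcomp c r^-1) ->
  f \in SigmaL Q.
Proof.
move=> des1 desc.
(* On boxes consecutive for [t], equal descents make [f] compare as [r] does, and [r] is monotone
   for NW. *)
have step (t : 'S_n) i : DesL (pcomp t f^-1) = DesL (pcomp t r^-1) ->
    (Q (t^-1 (hi i)) (t^-1 (lo i)) -> f (t^-1 (hi i)) <= f (t^-1 (lo i)))%g /\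
    (Q (t^-1 (lo i)) (t^-1 (hi i)) -> f (t^-1 (lo i)) <= f (t^-1 (hi i)))%g.
  move=> /setP/(_ i); rewrite !DesL_conj => E.
  have ne_i : (t^-1 (hi i) != t^-1 (lo i))%g.
    by rewrite (inj_eq perm_inj) -val_eqE /= neq_ltn leqnn orbT.
  split=> [hl|lh]; first by rewrite ltnW // E (SigmaL_lt r_SigmaL).
  by rewrite leqNgt E -leqNgt; apply: (elimT (SigmaLP _ _) r_SigmaL).
have row d (a b : 'I_n) : b = a + d :> nat -> y a = y b -> f b <= f a.
  elim: d b => [|d IHd] b Eb yab.
    by rewrite (_ : b = a) //; apply: val_inj; rewrite /= Eb addn0.
  have lt_ad : a + d < n.-1 by have := ltn_ord b; lia.
  set i := Ordinal lt_ad.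
  have Ehi : hi i = b by apply: val_inj; rewrite /= Eb addnS.
  have le_al : a <= lo i by rewrite /= leq_addr.
  have le_lb : lo i <= b by rewrite Eb /= addnS.
  have yal : y a = y (lo i) by move: le_al le_lb; rewrite !idE; lia.
  apply: leq_trans (IHd (lo i) erefl yal).
  have [] := step 1%g i; first by rewrite !pcomp1l.
  rewrite invg1 !perm1 Ehi => /(_ _)-> //.
  by move: le_lb; rewrite /weakly_NW idE -yal yab ltnn eqxx leqnn andbT.
have col d (a b : 'I_n) : c b = c a + d :> nat -> x a = x b -> f a <= f b.
  elim: d b => [|d IHd] b Eb xab.
    rewrite (_ : b = a) //; apply: (@perm_inj _ c); apply: val_inj.
    by rewrite /= Eb addn0.
  have lt_ad : c a + d < n.-1 by have := ltn_ord (c b); lia.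
  set i := Ordinal lt_ad; set l := (c^-1 (lo i))%g.
  have cl : c l = c a + d :> nat by rewrite permKV.
  have Ehi : (c^-1 (hi i) = b)%g.
    by apply: (canLR (permK c)); apply: val_inj; rewrite /= Eb addnS.
  have le_al : c a <= c l by rewrite cl leq_addr.
  have le_lb : c l <= c b by rewrite Eb cl addnS.
  have xal : x a = x l by move: le_al le_lb; rewrite !cE; lia.
  apply: leq_trans (IHd l cl xal) _.
  have [_] := step c i desc; rewrite Ehi -/l => -> //.
  by move: le_lb; rewrite /weakly_NW cE -xal xab ltnn eqxx leqnn.
apply/SigmaLP => a b /andP[le_x le_y].
(* The corner in the row of [a] and the column of [b] splits the comparison into one along a row and
   one along a column. *)
have [d xd yd] := left_justified le_x.
apply: leq_trans (_ : f d <= _).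
  apply: (row (a - d)); last by [].
  by rewrite subnKC // idE yd xd eqxx le_x orbT.
apply: (col (c b - c d)); last by [].
by rewrite subnKC // cE xd yd eqxx le_y orbT.
Qed.

Lemma mem_J (f t : 'S_n) : (pcomp t f^-1 \in J f) = (t \in SigmaL P).
Proof.
apply/imsetP/idP => [[u uP]|tP]; last by exists t.
by move/mulgI => ->.
Qed.

Lemma J_shift (f g s : 'S_n) : s \in J f -> pcomp s (pcomp f g^-1) \in J g.
Proof.
case/imsetP=> t tP ->; rewrite pcompA (_ : pcomp _ f = t) ?mem_J //.
by rewrite /pcomp mulKVg.
Qed.

Lemma is_interval_J f : f \in SigmaL Q -> is_intervalL (J f).
Proof.
move=> fQ; apply/existsP; exists f^-1%g; apply/existsP; exists (pcomp c f^-1).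
by rewrite leL_ends // J_interval //=.
Qed.

(** Right translation matches [pcomp t g^-1] with [pcomp t f^-1]; order and descents depend on [t]
    alone. *)
Lemma J_equivD f g : f \in SigmaL Q -> g \in SigmaL Q -> equivD (J f) (J g).
Proof.
move=> fQ gQ; apply/and3P; split; try exact: is_interval_J.
have shift_t t : pcomp (pcomp t g^-1) (pcomp g f^-1) = pcomp t f^-1.
  by rewrite pcompA (_ : pcomp _ g = t) // /pcomp mulKVg.
have [||||h iso_h psi_h] := @poset_iso_of_inverse _ _ (J f) (J g) (@leL n) (@leL n)
  (fun s => pcomp s (pcomp g f^-1)).
- by move=> s; apply: J_shift.
- by move=> s u _ _ /mulgI.
- move=> _ /imsetP[t tP ->]; exists (pcomp t g^-1); last exact: shift_t.
  by rewrite mem_J.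
- by move=> _ _ /imsetP[t tP ->] /imsetP[u uP ->]; rewrite !shift_t; apply: leL_conj_eq.
apply/existsP; exists h; rewrite iso_h; apply/forallP => s; rewrite -(psi_h s).
have /imsetP[t tP ->] := valP (h s); rewrite shift_t; apply/eqP.
exact: DesL_conj_eq.
Qed.

(* An isomorphism preserves covers, and a cover together with the descents of
   its ends reveals the simple reflection it multiplies by, so the isomorphism
   is a right translation. *)
Lemma equivD_translation f (I : {set 'S_n}) : f \in SigmaL Q -> equivD (J f) I ->
  exists2 w, I = [set pcomp s w | s in J f] &
             forall s, s \in J f -> DesL (pcomp s w) = DesL s.
Proof.
move=> fQ /and3P[_ /existsP[s0 /existsP[t0 /andP[st0 /eqP->]]]].
case/existsP=> h /andP[/and3P[/injectiveP h_inj /forallP h_onto /forallP h_mono] h_des].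
have leh s u : leL (val (h s)) (val (h u)) = leL (val s) (val u).
  by apply/eqP; move/forallP: (h_mono s); apply.
have Jb : f^-1%g \in J f by rewrite -(pcomp1l f^-1) mem_J id_SigmaL.
pose b : {s | s \in J f} := exist _ f^-1%g Jb.
(* The image of the bottom [f^-1] dictates the translation; the induction climbs a chain of covers
   from there. *)
have hE s : val (h s) = pcomp (val s) (pcomp f (val (h b))).
  have : leL f^-1%g (val s) by have := valP s; rewrite /= in_J // => /andP[].
  case/connectP=> p; elim/last_ind: p s => [|p u IHp] s /=.
    move=> _ Es; rewrite (_ : s = b); last exact: val_inj.
    by rewrite pcompA /= (_ : pcomp _ f = 1%g) ?pcomp1l // /pcomp mulgV.
  rewrite rcons_path last_rcons => /andP[pth cov] Es.
  set v := last _ p in cov; rewrite -Es in cov.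
  have le_bv : leL f^-1%g v by apply/connectP; exists p.
  have le_vs : leL v (val s) by apply: connect1.
  have vJ : v \in J f.
    rewrite in_J // le_bv; apply: leL_trans le_vs _.
    by have := valP s; rewrite /= in_J // => /andP[].
  have := IHp (exist _ v vJ) pth erefl; set s' := exist _ v vJ => Eh.
  have le_h : leL (val (h s')) (val (h s)) by rewrite leh.
  (* [z] is the first step of a chain from [h s'] to [h s]. Its preimage lies between [v] and [s]
     and is not [v], so it is [s]: the image of a cover is a cover. *)
  have /connectP[[|z q] /= pq lq] := le_h.
    move/val_inj/h_inj: lq => Ess; move: cov => /coverL_Inv.
    by rewrite Ess properxx.
  case/andP: pq => cov_z pq.
  have le_zs : leL z (val (h s)) by apply/connectP; exists q.
  have le_sz : leL (val (h s')) z by apply: connect1.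
  have zI : z \in intervalL s0 t0.
    have := valP (h s'); have := valP (h s); rewrite /= !inE => /andP[_ st] /andP[ss _].
    by rewrite (leL_trans ss le_sz) (leL_trans le_zs st).
  have /codomP[u' Eu] := h_onto (exist _ z zI).
  have Ez : z = val (h u') by rewrite -Eu.
  rewrite Ez !leh in le_zs le_sz.
  have Eus : val u' = val s.
    apply: coverL_between cov le_sz le_zs _; apply: contraTneq cov_z => Eus.
    have Eu' : u' = s' by apply: val_inj.
    by rewrite Ez Eu'; apply/negP => /coverL_Inv; rewrite properxx.
  have Ezs : z = val (h s) by rewrite Ez; congr (val (h _)); apply: val_inj.
  case/existsP: cov => i /andP[des_i /eqP Esi].
  case/existsP: cov_z => j /andP[des_j /eqP Ezj].
  have hdes s1 : DesL (val (h s1)) = DesL (val s1) by apply/eqP; move/forallP: h_des; apply.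
  (* [j] is an ascent of [v] and a descent of [s], and [i] is the only descent gained by this
     cover. *)
  have Eji : j = i.
    apply: (DesL_cover des_i); first by rewrite hdes in des_j.
    rewrite -Esi -hdes -Ezs Ezj in_DesL.
    have [-> ->] := simple_inv_swap (val (h s')) j.
    by rewrite -notin_DesL.
  by rewrite -Ezs Ezj Eji Eh Esi pcompA.
exists (pcomp f (val (h b))); last first.
  move=> s sJ; have := hE (exist _ s sJ) => /= <-.
  by move/forallP/(_ (exist _ s sJ))/eqP: h_des.
apply/setP => u; apply/idP/imsetP => [uI | [s sJ ->]].
  have /codomP[s Es] := h_onto (exist _ u uI).
  by exists (val s); [exact: valP | rewrite -hE -Es].
by have := hE (exist _ s sJ) => /= <-; apply: valP.
Qed.

Lemma classD_J I : reflect (exists2 f, f \in SigmaL Q & I = J f) (I \in classD (J r)).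
Proof.
rewrite inE; apply: (iffP idP) => [|[f fQ ->]]; last exact: J_equivD r_SigmaL fQ.
case/(equivD_translation r_SigmaL) => w EI des.
(* With this [f], translation by [w] turns [pcomp t r^-1] into [pcomp t f^-1]. *)
pose f := (pcomp r^-1 w)^-1%g.
have Ef t : pcomp (pcomp t r^-1) w = pcomp t f^-1 by rewrite /f invgK pcompA.
have des_t t : t \in SigmaL P -> DesL (pcomp t f^-1) = DesL (pcomp t r^-1).
  by move=> tP; rewrite -Ef des // mem_J.
exists f.
  by apply: SigmaL_of_DesL; [rewrite -[f^-1%g]pcomp1l -[r^-1%g]pcomp1l|];
    apply: des_t; [exact: id_SigmaL | exact: c_SigmaL].
rewrite EI; apply/setP => u; apply/imsetP/imsetP => [[_ /imsetP[t tP ->] ->]|[t tP ->]].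
  by exists t; rewrite ?Ef.
by exists (pcomp t r^-1); rewrite ?mem_J ?Ef.
Qed.

(** [r] inverts only pairs in a common row, and NW makes every [f] invert these. *)
Lemma leL_r_SigmaL f : f \in SigmaL Q -> leL r f.
Proof.
move=> fQ; apply/leL_ltP => a b lt_ab; rewrite ltnNge rE => lt_r.
apply: (SigmaL_lt fQ); last by rewrite -val_eqE /= neq_ltn lt_ab orbT.
by have := ltnW lt_ab; rewrite idE /weakly_NW; move: lt_r; lia.
Qed.

(** If [f] inverts [a < b], then NW fails for the pair, so [b] is strictly to the right of [a] and
    [m] inverts it too. *)
Lemma leL_SigmaL_m f : f \in SigmaL Q -> leL f m.
Proof.
move=> /SigmaLP fQ; apply/leL_ltP => a b lt_ab lt_f.
have : ~~ Q a b by apply: contraL lt_f => /fQ; rewrite -leqNgt.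
by have := ltnW lt_ab; rewrite ltnNge mE idE /weakly_NW; lia.
Qed.

(** Here [R] is NE with each box renamed by its entry under [f], as in the poset of a filling. *)
Lemma translateSigma_relabel (f : 'S_n) (R : rel 'I_n) :
  (forall a b, R (f a) (f b) = P a b) -> SigmaL R = J f.
Proof.
move=> RE; apply/setP => s; apply/SigmaLP/imsetP => [sR|[t /SigmaLP tP ->] i j].
  exists (pcomp s f); last by rewrite /pcomp mulKg.
  by apply/SigmaLP => a b ab; rewrite !pcompE; apply: sR; rewrite RE.
by rewrite -[i](permKV f) -[j](permKV f) RE !pcompE !permK; apply: tP.
Qed.

(** The blocks are the rows: [r] keeps their order and reverses each, hence is an involution and
    equals [r^-1]. *)
Lemma w0_rows (alpha : seq nat) :
  (forall a, y a < size alpha) ->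
  (forall k, k < size alpha -> #|[set a | y a == k]| = nth 0 alpha k) ->
  w0 (~: comp_set n alpha) = r^-1%g.
Proof.
move=> y_lt y_fib.
have y_mono (a b : 'I_n) : a <= b -> y a <= y b by rewrite idE; lia.
have [|-> -> //] := @w0_blockwise n y _ y_mono (comp_setC_blk y_mono y_lt y_fib) r.
move=> a b lt_ab; rewrite ltnNge rE; have := ltnW lt_ab; rewrite idE.
by have := lt_ab; rewrite ltnNge idE; lia.
Qed.

(** In the reading order [m], the word of [c] increases within each column and decreases from one
    column to the next. Composing with the longest element reverses this, giving the permutation
    that inverts exactly the pairs within a block. *)
Lemma w1_columns (beta : seq nat) :
  (forall a, x a < size beta) ->
  (forall k, k < size beta -> #|[set a | x a == k]| = nth 0 (rev beta) k) ->
  w1 (comp_set n beta) = pcomp c m^-1.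
Proof.
(* [m] starts at the rightmost column, so blocks are columns numbered from the right; this matches
   the reversal of [beta]. *)
move=> x_lt x_fib; pose blk p := (size beta).-1 - x (m^-1 p)%g.
have blk_mono (p q : 'I_n) : p <= q -> blk p <= blk q.
  by rewrite -{1}[p](permKV m) -{1}[q](permKV m) mE /blk; lia.
have blk_lt p : blk p < size beta by rewrite /blk; have := x_lt (m^-1 p)%g; lia.
have blk_fib k : k < size beta -> #|[set p | blk p == k]| = nth 0 beta k.
  move=> lt_k; have := @x_fib ((size beta).-1 - k); rewrite nth_rev; last by lia.
  rewrite (_ : _ - _.+1 = k); last by lia.
  move=> <-; last by lia.
  rewrite -[RHS](card_imset _ (@perm_inj _ m)); apply: eq_card => p.
  rewrite -[p](permKV m) mem_imset ?inE /blk ?permK; last exact: perm_inj.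
  by have := x_lt (m^-1 p)%g; lia.
pose w := pcomp (perm (@rev_ord_inj n)) (pcomp c m^-1).
have rev2 s : pcomp (perm (@rev_ord_inj n)) (pcomp (perm (@rev_ord_inj n)) s) = s.
  by apply/permP => p; rewrite !pcompE !(permE (@rev_ord_inj n)) rev_ordK.
have [|w0E _] := @w0_blockwise n blk _ blk_mono (comp_setC_blk blk_mono blk_lt blk_fib) w;
  last by rewrite /w1 w0_setT w0E rev2.
move=> p q lt_pq; rewrite !pcompE !(permE (@rev_ord_inj n)) /=.
have -> : (n - (c (m^-1 q)%g).+1 < n - (c (m^-1 p)%g).+1) = (c (m^-1 p)%g < c (m^-1 q)%g).
  by have := ltn_ord (c (m^-1 p)%g); have := ltn_ord (c (m^-1 q)%g); lia.
move: lt_pq; rewrite -{1}[p](permKV m) -{1}[q](permKV m) /blk !ltnNge mE cE.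
by have := x_lt (m^-1 p)%g; have := x_lt (m^-1 q)%g; lia.
Qed.

End Core.

(** * Enumerating and reading diagrams *)

Lemma total_order_enum (T : finType) n (le : rel T) : #|T| = n ->
  total le -> antisymmetric le -> transitive le ->
  exists2 e : 'I_n -> T, bijective e & forall a b, le (e a) (e b) = (a <= b).
Proof.
move=> cardT le_total le_anti le_trans.
have size_s : size (sort le (enum T)) == n by rewrite size_sort -cardE cardT.
pose e (a : 'I_n) := tnth (Tuple size_s) a.
have uniq_s : uniq (sort le (enum T)) by rewrite sort_uniq enum_uniq.
have e_inj : injective e by apply/injectiveP; rewrite /injectiveb /dinjectiveb map_tnth_enum.
exists e; first by apply: inj_card_bij => //; rewrite cardT card_ord.
have mono (a b : 'I_n) : a <= b -> le (e a) (e b).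
  move=> le_ab; rewrite /e !(tnth_nth (e a)) /=.
  apply: (sorted_leq_nth le_trans) => //; rewrite ?inE ?(eqP size_s) //.
    by move=> u; have := le_total u u; rewrite orbb.
  exact: sort_sorted.
move=> a b; apply/idP/idP => [le_e|]; last exact: mono.
rewrite leqNgt; apply/negP => lt_ba.
have /e_inj Eab : e a = e b by apply: le_anti; rewrite le_e mono // ltnW.
by rewrite Eab ltnn in lt_ba.
Qed.

Definition lex_leq (T : Type) (u v : T -> nat) : rel T :=
  fun a b => (u a < u b) || (u a == u b) && (v a <= v b).

Lemma lex_enum (T : finType) n (u v : T -> nat) : #|T| = n ->
  (forall a b, u a = u b -> v a = v b -> a = b) ->
  exists2 e : 'I_n -> T, bijective e &
    forall a b : 'I_n, (a <= b) = lex_leq u v (e a) (e b).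
Proof.
move=> cardT uv_inj.
have [|||e e_bij eE] := @total_order_enum T n (lex_leq u v) cardT; last by exists e.
- by move=> a b; rewrite /lex_leq; case: ltngtP => //= _; apply: leq_total.
- move=> a b; rewrite /lex_leq; case: ltngtP => //= Euab; rewrite -eqn_leq => /eqP.
  exact: uv_inj.
by move=> b a d; rewrite /lex_leq; lia.
Qed.

(** [e] sends a rank to the element of that rank, so the wanted permutation is its inverse. *)
Lemma lex_perm n (u v : 'I_n -> nat) :
  (forall a b, u a = u b -> v a = v b -> a = b) ->
  exists s : 'S_n, forall a b, (s a <= s b) = lex_leq u v a b.
Proof.
case/(lex_enum (card_ord n)) => e /bij_inj e_inj eE.
exists (perm e_inj)^-1%g => a b; rewrite eE -!(permE e_inj) !permKV //.
Qed.

Section Diagram.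
Context (n : nat) (D : {set box n}) (e : 'I_n -> {b | b \in D}).
Context (e_bij : bijective e).

Lemma enum_diagram_ex b : b \in D -> exists a, val (e a) = b.
Proof. by case: e_bij => e' _ eK bD; exists (e' (exist _ b bD)); rewrite eK. Qed.

Lemma card_diagram (p : pred (box n)) : #|[set a | p (val (e a))]| = #|[set b in D | p b]|.
Proof.
have ve_inj : injective (fun a => val (e a)) by move=> a b /val_inj/(bij_inj e_bij).
rewrite -(card_imset _ ve_inj); apply: eq_card => b; rewrite inE.
apply/imsetP/andP => [[a] | [/enum_diagram_ex[a <-] pa]].
  by rewrite inE => pa ->; split; first exact: valP.
by exists a; rewrite ?inE.
Qed.

Lemma standardP (F : filling D) :
  standard F <-> exists t : 'S_n, forall a, F (e a) = t a.
Proof.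
case: e_bij => e' eK e'K; split=> [/andP[/injectiveP F_inj _]|[t tE]].
  have inj : injective (fun a => F (e a)) by move=> a b /F_inj/(can_inj eK).
  by exists (perm inj) => a; rewrite permE.
have FE b : F b = t (e' b) by rewrite -tE e'K.
apply/andP; split; first by apply/injectiveP => b b'; rewrite !FE => /perm_inj/(can_inj e'K).
apply/forallP => k; apply/codomP; exists (e (t^-1 k)%g).
by rewrite tE permKV.
Qed.

Lemma filling_of_perm (t : 'S_n) : exists F : filling D, forall a, F (e a) = t a.
Proof.
by case: e_bij => e' eK _; exists [ffun b => t (e' b)] => a; rewrite ffunE eK.
Qed.

Lemma filling_ext (F G : filling D) : (forall a, F (e a) = G (e a)) -> F = G.
Proof. by case: e_bij => e' _ e'K FG; apply/ffunP => b; rewrite -[b]e'K. Qed.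

Lemma filling_relE (F : filling D) (t : 'S_n) a b :
  (forall a, F (e a) = t a) ->
  filling_rel F (t a) (t b) = le_box (val (e a)) (val (e b)).
Proof.
move=> FE; have F_inj : injective F.
  by have /standardP/andP[/injectiveP] : exists t : 'S_n, forall a, F (e a) = t a by exists t.
apply/existsP/idP => [[b1 /existsP[b2]]|le_ab].
  by rewrite -!FE => /and3P[/eqP/F_inj-> /eqP/F_inj->].
by exists (e a); apply/existsP; exists (e b); rewrite !FE !eqxx.
Qed.

Section Reading.
Context (before : rel (box n)) (g : 'S_n).
Context (gE : forall a b, (g a <= g b) = before (val (e a)) (val (e b))).

Lemma boxes_byE : boxes_by before D = [seq e (g^-1 i)%g | i <- enum 'I_n].
Proof.
case: (e_bij) => e' eK e'K.
have E b b' : before (val b) (val b') = (g (e' b) <= g (e' b')).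
  by rewrite gE !e'K.
apply: (@sorted_eq _ (fun b b' => before (val b) (val b'))).
- by move=> b2 b1 b3; rewrite !E; apply: leq_trans.
- move=> b b'; rewrite !E -eqn_leq => /eqP/val_inj/perm_inj; exact: (can_inj e'K).
- by apply: sort_sorted => b b'; rewrite !E; apply: leq_total.
- rewrite sorted_map; apply: (@sub_sorted _ (fun i j : 'I_n => i <= j)).
    by move=> i j le_ij /=; rewrite E !eK !permKV.
  by have := iota_sorted 0 n; rewrite -val_enum_ord sorted_map.
rewrite perm_sort; apply: uniq_perm; rewrite ?enum_uniq //.
  rewrite map_inj_uniq ?enum_uniq // => i j.
  by move=> /(can_inj eK)/perm_inj.
move=> b; rewrite mem_enum /=; apply/esym/mapP; exists (g (e' b)); rewrite ?mem_enum //.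
by rewrite permK e'K.
Qed.

(** The box in position [i] of the reading is the one labelled [g^-1 i]; the word is thus a
    permutation and the default of [perm_of_word] is not reached. *)
Lemma readE (F : filling D) (t : 'S_n) :
  (forall a, F (e a) = t a) -> read before F = pcomp t g^-1.
Proof.
move=> FE; rewrite /read boxes_byE -map_comp /perm_of_word.
set w := [seq _ | i <- _].
have wE : [ffun i : 'I_n => nth i w i] = pval (pcomp t g^-1).
  apply/ffunP => i; rewrite ffunE (nth_map i) ?size_enum_ord // nth_ord_enum /= FE.
  by rewrite -permM -/(pcomp t g^-1) -pvalE.
by rewrite wE; apply: valKd.
Qed.

Lemma fill_alongE a : fill_along before D (e a) = g a.
Proof.
rewrite ffunE boxes_byE.
have e_inj : injective (fun i => e (g^-1 i)%g).
  by move=> i j /(bij_inj e_bij)/perm_inj.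
have := index_map e_inj (enum 'I_n) (g a).
by rewrite permK index_enum_ord => ->; rewrite valKd.
Qed.
End Reading.

End Diagram.

(** * Reflected diagrams and composition diagrams *)

Lemma leq_top_row n (D : {set box n}) b : b \in D -> b.2 <= top_row D.
Proof. by move=> bD; rewrite /top_row (bigD1 b) // leq_maxl. Qed.

Lemma flip_box_row n (D : {set box n}) b : b \in D ->
  (flip_box D b).2 = top_row D - b.2 :> nat.
Proof. by move=> bD; rewrite val_insubd (flip_row_subproof bD). Qed.

Lemma flip_boxK n (D : {set box n}) b : b \in D -> flip_box D (flip_box D b) = b.
Proof.
move=> bD; have le_b := leq_top_row bD; have Erow := flip_box_row bD.
case: b bD le_b Erow => bx b2 bD /= le_b Erow; congr pair.
by apply: val_inj; rewrite val_insubd Erow subKn // ltn_ord.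
Qed.

Lemma flip_enum n (D : {set box n}) (e : 'I_n -> {b | b \in D}) : bijective e ->
  exists2 e' : 'I_n -> {b | b \in flip D},
    bijective e' & forall a, val (e' a) = flip_box D (val (e a)).
Proof.
case=> d eK dK.
have mem_e a : flip_box D (val (e a)) \in flip D by apply/imset_f/valP.
exists (fun a => exist (fun b => b \in flip D) _ (mem_e a)) => //.
exists (fun b => d (exist (fun b => b \in D) _ (flip_box_in (valP b)))) => [a|b].
  by rewrite -[RHS]eK; congr d; apply: val_inj; rewrite /= flip_boxK //; exact: valP.
apply: val_inj; rewrite /= dK /=; case: b => _ /= /imsetP[b bD ->].
by rewrite (flip_boxK bD).
Qed.

Lemma flip_fillingE n (D : {set box n}) (T : filling D) b (c : {b | b \in flip D}) :
  val c = flip_box D (val b) -> flip_filling T c = T b.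
Proof.
move=> Ec; rewrite ffunE; congr (T _); apply: val_inj.
by rewrite /= Ec flip_boxK //; exact: valP.
Qed.

Section Composition.
Context (n : nat) (alpha : seq nat) (alpha_n : is_comp n alpha).

Lemma in_tcd (b : box n) : (b \in tcd n alpha) = (b.1 < nth 0 alpha b.2).
Proof. by rewrite inE. Qed.

Lemma sumn_alpha : sumn alpha = n.
Proof. by move: alpha_n => /andP[_ /eqP]. Qed.

Lemma size_alpha : size alpha <= n.
Proof.
rewrite -sumn_alpha; move: alpha_n => /andP[+ _].
by elim: alpha => //= k l IHl /andP[k_gt0 /IHl]; lia.
Qed.

Lemma part_le k : nth 0 alpha k <= n.
Proof.
rewrite -sumn_alpha; have [lt_k|/(nth_default 0)-> //] := ltnP k (size alpha).
by rewrite -{2}(cat_take_drop k alpha) (drop_nth 0) // sumn_cat /=; lia.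
Qed.

Lemma card_row k : k < n -> #|[set b in tcd n alpha | b.2 == k :> nat]| = nth 0 alpha k.
Proof.
move=> lt_k; rewrite -[RHS]card_ord.
pose h (i : 'I_(nth 0 alpha k)) : box n := (widen_ord (part_le k) i, Ordinal lt_k).
have h_inj : injective h by move=> i j [] /val_inj.
rewrite -(card_imset _ h_inj); apply: eq_card => -[b1 b2]; rewrite inE in_tcd /=.
apply/andP/imsetP => [[lt_b /eqP Eb]|[i _ [-> ->]]]; last by rewrite /= eqxx.
rewrite Eb in lt_b; exists (Ordinal lt_b) => //.
by congr pair; apply: val_inj.
Qed.

Lemma card_column k : k < n ->
  #|[set b in tcd n alpha | b.1 == k :> nat]| = count (leq k.+1) alpha.
Proof.
move=> lt_k.
have le_n := size_alpha.
transitivity #|[set j : 'I_n | k < nth 0 alpha j]|.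
  pose h (j : 'I_n) : box n := (Ordinal lt_k, j).
  have h_inj : injective h by move=> i j [].
  rewrite -(card_imset _ h_inj); apply: eq_card => -[b1 b2]; rewrite inE in_tcd /=.
  apply/andP/imsetP => [[lt_b /eqP Eb]|[i + [-> ->]]]; last by rewrite inE.
  by exists b2; rewrite ?inE -?Eb //; congr pair; apply: val_inj.
(* Padding with empty rows lets the count range over all [n] rows of the grid. *)
pose beta := alpha ++ nseq (n - size alpha) 0.
have size_beta : size beta = n by rewrite size_cat size_nseq subnKC.
have nth_beta j : nth 0 beta j = nth 0 alpha j.
  rewrite nth_cat nth_nseq if_same; case: ltnP => // le_j.
  by rewrite nth_default.
rewrite (_ : count _ alpha = count (leq k.+1) beta); last first.
  by rewrite count_cat count_nseq /= mul0n addn0.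
rewrite -[in RHS](mkseq_nth 0 beta) size_beta count_map -val_enum_ord count_map.
rewrite cardsE cardE size_filter enumT; apply: eq_count => j.
by rewrite /= nth_beta.
Qed.

Lemma card_tcd : #|[set: {b | b \in tcd n alpha}]| = n.
Proof.
rewrite cardsT card_sig -[RHS]sumn_alpha.
rewrite -sum1_card (partition_big (fun b : box n => b.2) xpredT) //=.
transitivity (\sum_(k < n) nth 0 alpha k).
  apply: eq_bigr => k _; rewrite -card_row ?ltn_ord // -sum1_card.
  by apply: eq_bigl => b; rewrite !inE.
rewrite sumnE (big_nth 0) big_mkord -(subnKC size_alpha) big_split_ord /=.
by rewrite [X in _ + X]big1 ?addn0 // => k _; rewrite nth_default //= leq_addr.
Qed.

Local Notation la := (sort geq alpha).
Local Notation beta := (rev (conj_part la)).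

Lemma head_sorted_max k : nth 0 alpha k <= head 0 la.
Proof.
have [lt_k|le_k] := ltnP k (size alpha); last by rewrite nth_default.
have : nth 0 alpha k \in la by rewrite mem_sort mem_nth.
have geq_trans : transitive geq by move=> u v w /= uv vw; apply: leq_trans vw uv.
have := sort_sorted (fun u v => leq_total v u) alpha.
case: la => //= u l; rewrite path_sortedE // => /andP[/allP le_u _].
by rewrite inE => /predU1P[->|/le_u].
Qed.

Lemma size_beta : size beta = head 0 la.
Proof. by rewrite size_rev size_map size_iota. Qed.

(** Sorting does not affect the number of parts exceeding [k], so the conjugate partition lists the
    column heights of the unsorted diagram. *)
Lemma nth_rev_beta k : k < size beta -> nth 0 (rev beta) k = count (leq k.+1) alpha.
Proof.
rewrite size_beta => lt_k; rewrite revK (nth_map 0) ?size_iota // nth_iota //.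
by rewrite add1n; apply/seq.permP; rewrite perm_sort.
Qed.

End Composition.

(** * The class of X_alpha *)

Section Assembly.
Context (n : nat) (alpha : seq nat) (e : 'I_n -> {b | b \in tcd n alpha}).
Context (e_bij : bijective e).

Let x a : nat := (val (e a)).1.
Let y a : nat := (val (e a)).2.
Local Notation P := (weakly_NE x y).
Local Notation Q := (weakly_NW x y).

Lemma coords_inj a b : x a = x b -> y a = y b -> a = b.
Proof.
move=> /val_inj Ex /val_inj Ey; apply: (bij_inj e_bij); apply: val_inj.
by case: (val _) (val (e b)) Ex Ey => ? ? [? ?] /= -> ->.
Qed.

Lemma tcd_left_justified b k : k <= x b -> exists2 d, x d = k & y d = y b.
Proof.
move=> le_k; have lt_k : k < n by apply: leq_ltn_trans le_k (ltn_ord _).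
have : (Ordinal lt_k, (val (e b)).2) \in tcd n alpha.
  have := valP (e b); rewrite !in_tcd /=; exact: leq_ltn_trans.
by case/(enum_diagram_ex e_bij) => d Ed; exists d; rewrite /x /y Ed.
Qed.

(** Row and column conditions give monotonicity for NE by passing through the corner in the column
    of [a] and the row of [b], which is a box because rows are left-justified. *)
Lemma SETP (F : filling (tcd n alpha)) :
  F \in SET n alpha <-> exists2 t : 'S_n, t \in SigmaL P & forall a, F (e a) = t a.
Proof.
split; rewrite inE; last first.
  case=> t tP FE; apply/and3P; split; first by apply/(standardP e_bij); exists t.
    apply/forallP => b; apply/forallP => d; apply/implyP; case: e_bij => e' _ eK.
    rewrite -[b]eK -[d]eK !FE => /andP[/eqP Ey lt_x]; apply: SigmaL_lt tP _ _.
      by rewrite /weakly_NE /x /y Ey ltnW /=.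
    by apply: contraTneq lt_x => ->; rewrite ltnn.
  apply/forallP => b; apply/forallP => d; apply/implyP; case: e_bij => e' _ eK.
  rewrite -[b]eK -[d]eK !FE => /andP[/eqP Ex lt_y]; apply: SigmaL_lt tP _ _.
    by rewrite /weakly_NE /x /y Ex leqnn ltnW.
  by apply: contraTneq lt_y => ->; rewrite ltnn.
case/and3P=> /(standardP e_bij)[t FE] /forallP row /forallP col; exists t => //.
apply/SigmaLP => a b /andP[le_x le_y]; have [d xd yd] := tcd_left_justified le_x.
apply: (@leq_trans (t d)).
  have [->|ne_ad] := eqVneq a d; first exact: leqnn.
  rewrite -!FE ltnW //; move/forallP: (col (e a)) => /(_ (e d))/implyP; apply.
  apply/andP; split; first by apply/eqP/val_inj; rewrite -[RHS]/(x d) xd.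
  rewrite -/(y a) -/(y d) ltn_neqAle yd le_y andbT.
  by apply: contra ne_ad => /eqP Ey; apply/eqP/coords_inj; rewrite ?xd ?yd.
have [->|ne_db] := eqVneq d b; first exact: leqnn.
rewrite -!FE ltnW //; move/forallP: (row (e d)) => /(_ (e b))/implyP; apply.
apply/andP; split; first by apply/eqP/val_inj; rewrite -[LHS]/(y d) yd.
rewrite -/(x d) -/(x b) ltn_neqAle xd le_x andbT.
by apply: contra ne_db => /eqP Ex; apply/eqP/coords_inj; rewrite ?xd ?yd.
Qed.

Local Notation Ex := (flip (DX n alpha)).

(** Transposing and reflecting send the box (x, y) to (y, K - x), which turns the product order into
    NW. *)
Lemma enum_flip_DX :
  exists K, exists2 e' : 'I_n -> {b | b \in Ex}, bijective e' &
  forall a, [/\ x a <= K, (val (e' a)).1 = y a :> nat & (val (e' a)).2 = K - x a :> nat].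
Proof.
have memD a : ((val (e a)).2, (val (e a)).1) \in DX n alpha by apply/imset_f/valP.
pose eD a : {b | b \in DX n alpha} := exist (fun b => b \in DX n alpha) _ (memD a).
have eD_bij : bijective eD.
  apply: inj_card_bij.
    move=> a b /(congr1 val) [Ey Ex]; apply: coords_inj; first by rewrite /x Ex.
    by rewrite /y Ey.
  rewrite card_sig (bij_eq_card e_bij) card_sig.
  exact: leq_imset_card.
have [e' e'_bij e'E] := flip_enum eD_bij.
exists (top_row (DX n alpha)); exists e' => // a.
have := leq_top_row (memD a); rewrite e'E flip_box_row; last exact: memD.
by split.
Qed.

Lemma STP (e' : 'I_n -> {b | b \in Ex}) (T : filling Ex) : bijective e' ->
  (forall a b, le_box (val (e' a)) (val (e' b)) = Q a b) ->
  T \in ST Ex <-> exists2 f : 'S_n, f \in SigmaL Q & forall a, T (e' a) = f a.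
Proof.
move=> e'_bij e'Q; split; rewrite inE.
  case/andP=> /(standardP e'_bij)[f TE] /forallP T_mono; exists f => //.
  apply/SigmaLP => a b; rewrite -e'Q -!TE.
  by move/forallP: (T_mono (e' a)) => /(_ (e' b))/implyP.
case=> f /SigmaLP fQ TE; apply/andP; split; first by apply/(standardP e'_bij); exists f.
apply/forallP => b; apply/forallP => d; apply/implyP; case: e'_bij => e2 _ eK.
by rewrite -[b]eK -[d]eK !TE e'Q; apply: fQ.
Qed.

End Assembly.

Theorem proposition5p8 (n : nat) (n_gt0 : 0 < n) (alpha : seq nat)
    (alpha_n : is_comp n alpha) :
  let C := CX n alpha in
  let Ex := flip (DX n alpha) in
  (C = [set SigmaL (filling_rel (flip_filling T)) | T in ST Ex]
   /\ is_minimum C (@leC n)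
        (intervalL (w0 (~: comp_set n alpha)) (wRB (T_cols n alpha)))
   /\ is_maximum C (@leC n)
        (intervalL (wBR (T_rows n alpha))
           (w1 (comp_set n (rev (conj_part (sort geq alpha)))))))
  /\ (exists f : {ffun {I | I \in C} -> {T | T \in ST Ex}},
        is_poset_iso (@leC n) (@leST n Ex) f).
Proof.
move=> C Ex.
have cardB : #|{: {b | b \in tcd n alpha}}| = n by rewrite -[RHS](card_tcd alpha_n) cardsT.
(* Labelling the boxes row by row makes [T_rows] the identity. *)
have [|e e_bij eE] := @lex_enum _ n (fun b : {b | b \in tcd n alpha} => (val b).2 : nat)
  (fun b => (val b).1 : nat) cardB.
  move=> [[b1 b2] bD] [[d1 d2] dD] /= /val_inj E2 /val_inj E1.
  by apply: val_inj; rewrite /= E1 E2.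
pose x a : nat := (val (e a)).1; pose y a : nat := (val (e a)).2.
have {}eE (a b : 'I_n) : (a <= b) = (y a < y b) || (y a == y b) && (x a <= x b).
  exact: eE.
have x_lt a : x a < n by apply: ltn_ord.
have xy_inj a b : x a = x b -> y a = y b -> a = b by apply: coords_inj.
have [|c cE] := @lex_perm n x y; first exact: xy_inj.
(* Since [x a < n], the coordinate [n - x a] reverses the horizontal order without truncation. *)
have [|r rE] := @lex_perm n y (fun a => n - x a).
  by move=> a b Ey Ex'; apply: xy_inj => //; have := x_lt a; have := x_lt b; lia.
have [|m mE] := @lex_perm n (fun a => n - x a) y.
  by move=> a b Ex' Ey; apply: xy_inj => //; have := x_lt a; have := x_lt b; lia.
have {}rE a b : (r a <= r b) = (y a < y b) || (y a == y b) && (x b <= x a).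
  by rewrite rE /lex_leq; have := x_lt a; have := x_lt b; lia.
have {}mE a b : (m a <= m b) = (x b < x a) || (x a == x b) && (y a <= y b).
  by rewrite mE /lex_leq; have := x_lt a; have := x_lt b; lia.
have just := @tcd_left_justified n alpha e e_bij.
pose Q := weakly_NW x y; pose J := translateSigma x y.
have rQ : r \in SigmaL Q by apply: r_SigmaL rE.
have mQ : m \in SigmaL Q by apply: m_SigmaL mE.
have JE f : f \in SigmaL Q -> J f = intervalL f^-1%g (pcomp c f^-1).
  exact: J_interval eE cE f.
have leJ f g : f \in SigmaL Q -> g \in SigmaL Q -> leC (J f) (J g) = leL f g.
  exact: leC_J eE cE f g.
have in_C I : I \in C <-> exists2 f, f \in SigmaL Q & I = J f.
  rewrite /C /CX (_ : [set _ | T in _] = J r).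
    by split=> /(classD_J eE cE rE just).
  apply/setP => s; apply/imsetP/imsetP => [[F /(SETP e_bij)[t tP FE] ->]|[t tP ->]].
    by exists t => //; apply: (readE e_bij) FE => a b; rewrite rE /before_RB /=.
  have [F FE] := filling_of_perm e_bij t.
  exists F; first by apply/(SETP e_bij); exists t.
  by apply/esym; apply: (readE e_bij) FE => a b; rewrite rE /before_RB /=.
have [K [e' e'_bij e'E0]] := enum_flip_DX e_bij.
have e'E a : [/\ x a <= K, (val (e' a)).1 = y a :> nat & (val (e' a)).2 = K - x a :> nat].
  exact: e'E0.
have e'Q a b : le_box (val (e' a)) (val (e' b)) = Q a b.
  rewrite /le_box; have [xa -> ->] := e'E a; have [xb -> ->] := e'E b.
  by rewrite /Q /weakly_NW; move: xa xb; lia.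
(* Columns of the reflected diagram are rows of [tcd], read top to bottom by increasing [x]. This is
   the order of the labels, so the reading permutation is 1 and the word of [T] is [f] itself. *)
have wTLE (T : filling Ex) (f : 'S_n) : (forall a, T (e' a) = f a) -> wTL T = f.
  move=> TE; rewrite /wTL (readE e'_bij (g := 1%g) _ TE) ?invg1 /pcomp ?mul1g // => a b.
  rewrite !perm1 eE /before_TL -val_eqE /=.
  by have [xa -> ->] := e'E a; have [xb -> ->] := e'E b; move: xa xb; lia.
(* The second reflection undoes the reversal of [x], so NW becomes NE again and the poset of the
   reflected filling is NE renamed by [f]. *)
have SigmaLE (T : filling Ex) (f : 'S_n) : (forall a, T (e' a) = f a) ->
    SigmaL (filling_rel (flip_filling T)) = J f.
  move=> TE; have [e2 e2_bij e2E] := flip_enum e'_bij.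
  apply: translateSigma_relabel => a b.
  rewrite (filling_relE e2_bij); last by move=> d; rewrite -TE; apply: flip_fillingE.
  rewrite /le_box !e2E !flip_box_row; try exact: valP.
  have := leq_top_row (valP (e' a)); have := leq_top_row (valP (e' b)).
  rewrite /flip_box /=; have [xa -> ->] := e'E a; have [xb -> ->] := e'E b.
  by rewrite /weakly_NE; move: xa xb; lia.
have STE := STP _ e'_bij e'Q.
have SE T : T \in ST Ex ->
    exists2 f, f \in SigmaL Q & SigmaL (filling_rel (flip_filling T)) = J f /\ wTL T = f.
  by case/STE=> f fQ TE; exists f; rewrite ?(SigmaLE _ f) ?(wTLE _ f).
have SE_onto I : I \in C ->
    exists2 T, T \in ST Ex & SigmaL (filling_rel (flip_filling T)) = I.
  case/in_C=> f fQ ->; have [T TE] := filling_of_perm e'_bij f.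
  by exists T; [apply/STE; exists f | apply: SigmaLE].
have SE_in T : T \in ST Ex -> SigmaL (filling_rel (flip_filling T)) \in C.
  by case/SE=> f fQ [-> _]; apply/in_C; exists f.
have T_rowsE a : T_rows n alpha (e a) = (1%g : 'S_n) a.
  apply: (fill_alongE e_bij) => a' b'.
  by rewrite !perm1 eE.
have T_colsE a : T_cols n alpha (e a) = c a.
  by apply: (fill_alongE e_bij) => a' b'; rewrite cE.
have y_lt a : y a < size alpha.
  rewrite ltnNge; apply: contraL (valP (e a)) => le_y.
  by rewrite in_tcd -leqNgt nth_default.
have y_fib k : k < size alpha -> #|[set a | y a == k]| = nth 0 alpha k.
  move=> lt_k; rewrite (card_diagram e_bij (fun b => b.2 == k :> nat)) card_row //.
  exact: leq_trans lt_k (size_alpha alpha_n).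
pose beta := rev (conj_part (sort geq alpha)).
have beta_le : size beta <= n.
  rewrite size_beta; case: (sort geq alpha) (mem_sort geq alpha) => //= u l mem_u.
  have : u \in alpha by rewrite -mem_u mem_head.
  by case/(nthP 0) => k _ <-; apply: part_le.
have x_lt_beta a : x a < size beta.
  have := valP (e a); rewrite size_beta in_tcd => /leq_trans; apply.
  exact: head_sorted_max.
have x_fib k : k < size beta -> #|[set a | x a == k]| = nth 0 (rev beta) k.
  move=> lt_k; rewrite (card_diagram e_bij (fun b => b.1 == k :> nat)).
  by rewrite nth_rev_beta // card_column // (leq_trans lt_k).
split; last first.
  have [||||f f_iso _] := @poset_iso_of_inverse _ _ C (ST Ex) (@leC n) (@leST n Ex)
    (fun T => SigmaL (filling_rel (flip_filling T))); last by exists f.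
  - exact: SE_in.
  - move=> T U /STE[f fQ TE] /STE[g gQ UE]; rewrite (SigmaLE _ f) // (SigmaLE _ g) // => Efg.
    (* Applying [leC] in both directions to the equal sets compares [f] and [g] both ways. *)
    have fg : f = g by apply: leL_anti; rewrite -leJ // Efg leJ ?leL_refl.
    by apply: (filling_ext e'_bij) => a; rewrite TE UE fg.
  - by move=> I /SE_onto.
  by move=> T U /SE[f fQ [-> Ef]] /SE[g gQ [-> Eg]]; rewrite leJ // /leST Ef Eg.
split.
  apply/setP => I; apply/idP/imsetP => [/SE_onto[T ST_T <-]|[T ST_T ->]].
    by exists T.
  exact: SE_in.
have rE_read (F : filling (tcd n alpha)) (t : 'S_n) :
    (forall a, F (e a) = t a) -> wRB F = pcomp t r^-1.
  by apply: (readE e_bij) => a b; rewrite rE.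
have mE_read (F : filling (tcd n alpha)) (t : 'S_n) :
    (forall a, F (e a) = t a) -> wBR F = pcomp t m^-1.
  by apply: (readE e_bij) => a b; rewrite mE.
(* The two intervals become [J r] and [J m], with ends [r^-1], [pcomp c r^-1] and [m^-1],
   [pcomp c m^-1]. *)
rewrite (w0_rows eE rE y_lt y_fib) (rE_read _ _ T_colsE).
rewrite (mE_read _ _ T_rowsE) pcomp1l (w1_columns cE mE x_lt_beta x_fib) -!JE //.
split; split.
- by apply/in_C; exists r.
- by move=> I /in_C[f fQ ->]; rewrite leJ //; apply: leL_r_SigmaL eE rE _ fQ.
- by apply/in_C; exists m.
by move=> I /in_C[f fQ ->]; rewrite leJ //; apply: leL_SigmaL_m eE mE _ fQ.
Qed.
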